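(* Let $c\le 0$ be a real number, let $N^{m+1}(c)$ be a space form of dimension $m+1$ ($m\ge 1$) of constant sectional curvature $c$, let $M^m$ be an $m$-dimensional manifold, and let $\vec{x}: M^m\to N^{m+1}(c)$ be an immersed hypersurface, with $M$ carrying the induced metric. Assume that the hypersurface is weakly convex and biharmonic. Then its mean curvature vector field satisfies $\vec{H}=0$ on $M$, i.e. the hypersurface is minimal.
   Context: All manifolds and maps are smooth; $M$ is not assumed compact or complete. Write $N=N^{m+1}(c)$ with metric $\langle\cdot,\cdot\rangle$ and Levi-Civita connection $D$. The induced metric on $M$ is $g_{ij}=\langle \partial_i\vec{x},\partial_j\vec{x}\rangle$, with Levi-Civita connection $\nabla$. The second fundamental form is the normal-bundle-valued form $h(X,Y)=D_XY-\nabla_XY$ for $X,Y$ tangent to $M$, and the mean curvature vector field is $\vec{H}=\frac1m\sum_{i=1}^m h(e_i,e_i)$, where $\{e_1,\dots,e_m\}$ is a local orthonormal frame of $M$. The hypersurface is biharmonic if $$-\Delta\vec{H}=\sum_{i=1}^m R^N(e_i,\vec{H})e_i ,$$ where $-\Delta=\sum_{i=1}^m\big(D_{e_i}D_{e_i}-D_{\nabla_{e_i}e_i}\big)$ acts on sections of the pullback bundle $\vec{x}^*TN$ ($D$ also denoting the pulled-back connection), and $R^N(X,Y)Z=D_XD_YZ-D_YD_XZ-D_{[X,Y]}Z$ is the curvature tensor of $N$. This is the Euler–Lagrange equation of the functional $\int_M|\tau(\vec{x})|^2\,dM$, with $\tau(\vec{x})$ the tension field of $\vec{x}$. For constant curvature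 $c$ the right-hand side equals $-cm\vec{H}$. The hypersurface is weakly convex if all its principal curvatures are nonnegative, i.e. there is a unit normal vector field $\nu$ along $M$ such that at every point all eigenvalues of the symmetric bilinear form $(X,Y)\mapsto\langle h(X,Y),\nu\rangle$ with respect to $g$ are nonnegative. *)

(* Defs.v *)
From HB Require Import structures.
From mathcomp Require Import all_boot all_order all_algebra.
From mathcomp Require Import all_classical all_reals all_analysis.

Set Implicit Arguments.
Unset Strict Implicit.
Unset Printing Implicit Defensive.

Import Order.TTheory GRing.Theory Num.Theory.
Import numFieldNormedType.Exports.

Local Open Scope classical_set_scope.
Local Open Scope ring_scope.

(* Manifolds are topological spaces with an atlas, and tensors are given by
   their components in the charts.  A tangent vector at a point of a chart is
   the row of its components; a vector field on an open set of a chart is a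
   function from coordinates to rows.  A chart is a pair of total functions
   [coord], [param], which are meaningful only on [dom] and [coord @` dom]. *)

(** * C^infinity functions on an open subset of a normed space *)

Fixpoint Cdiff {R : realType} {V W : normedModType R} (k : nat) (U : set V)
    (f : V -> W) : Prop :=
  if k is k'.+1 then
    (forall u, U u -> differentiable f u) /\
    (forall v : V, Cdiff k' U (fun u => 'D_v f u))
  else True.

(* For U open this is C^infinity: k times Frechet differentiable for all k. *)
Definition smooth_on {R : realType} {V W : normedModType R} (U : set V)
  (f : V -> W) : Prop := forall k, Cdiff k U f.

(** * Riemannian geometry in one coordinate system *)

Section Coordinates.
Context {R : realType}.

Definition form {n : nat} (G : 'M[R]_n) (v w : 'rV[R]_n) : R :=
  (v *m G *m w^T) 0 0.

Section Connection.
Context {n : nat}.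
Implicit Types (G : 'rV[R]_n -> 'M[R]_n) (y v w z : 'rV[R]_n).

(* The vector with components
   Gamma^k_(i j) v^i w^j, where Gamma^k_(i j) =
     1/2 G^(k l) (d_i G_(j l) + d_j G_(i l) - d_l G_(i j)). *)
Definition christoffel G y v w : 'rV[R]_n :=
  2^-1 *: ((\row_l (form ('D_v G y) w (delta_mx 0 l)
                  + form ('D_w G y) v (delta_mx 0 l)
                  - form ('D_(delta_mx 0 l) G y) v w)) *m invmx (G y)).

(* D_X Z, for a section Z of the pullback by F of the tangent bundle: the
   pullback by F of the Levi-Civita connection of G. With F = id it is the
   Levi-Civita connection itself. *)
Definition cov {V : normedModType R} G (F : V -> 'rV[R]_n) (X : V -> V)
    (Z : V -> 'rV[R]_n) : V -> 'rV[R]_n :=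
  fun u => 'D_(X u) Z u + christoffel G (F u) ('D_(X u) F u) (Z u).

Definition lie_bracket (X Y : 'rV[R]_n -> 'rV[R]_n) : 'rV[R]_n -> 'rV[R]_n :=
  fun y => 'D_(X y) Y y - 'D_(Y y) X y.

Definition curvature_op G (X Y Z : 'rV[R]_n -> 'rV[R]_n) y : 'rV[R]_n :=
  cov G id X (cov G id Y Z) y - cov G id Y (cov G id X Z) y
  - cov G id (lie_bracket X Y) Z y.

(* The curvature tensor R(v,w)z at y; being a tensor, it can be evaluated on
   the extensions of v, w, z by constant components. *)
Definition curvature G y v w z : 'rV[R]_n :=
  curvature_op G (cst v) (cst w) (cst z) y.

Definition sectional_curvature G y v w : R :=
  form (G y) (curvature G y v w w) v /
  (form (G y) v v * form (G y) w w - form (G y) v w ^+ 2).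

End Connection.

Section Submanifold.
Context {m n : nat}.
Variables (G : 'rV[R]_n -> 'M[R]_n) (F : 'rV[R]_m -> 'rV[R]_n).
Implicit Types (X Y : 'rV[R]_m -> 'rV[R]_m) (V : 'rV[R]_m -> 'rV[R]_n).

Definition push X : 'rV[R]_m -> 'rV[R]_n := fun u => 'D_(X u) F u.

Definition induced_metric (u : 'rV[R]_m) : 'M[R]_m :=
  \matrix_(i, j) form (G (F u)) ('D_(delta_mx 0 i) F u) ('D_(delta_mx 0 j) F u).

Definition nabla X Y : 'rV[R]_m -> 'rV[R]_m := cov induced_metric id X Y.

Definition second_form X Y : 'rV[R]_m -> 'rV[R]_n :=
  fun u => cov G F X (push Y) u - push (nabla X Y) u.

Definition orthonormal_at (u : 'rV[R]_m) (e : 'I_m -> 'rV[R]_m) : Prop :=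
  forall i j, form (induced_metric u) (e i) (e j) = (i == j)%:R.

Definition mean_curvature (E : 'I_m -> 'rV[R]_m -> 'rV[R]_m) :
    'rV[R]_m -> 'rV[R]_n :=
  fun u => m%:R^-1 *: \sum_(i < m) second_form (E i) (E i) u.

(* This is -Delta V in the convention Delta >= 0. *)
Definition rough_laplacian (E : 'I_m -> 'rV[R]_m -> 'rV[R]_m) V :
    'rV[R]_m -> 'rV[R]_n :=
  fun u => \sum_(i < m)
    (cov G F (E i) (cov G F (E i) V) u - cov G F (nabla (E i) (E i)) V u).

Definition biharmonic_eq (E : 'I_m -> 'rV[R]_m -> 'rV[R]_m) u : Prop :=
  let H := mean_curvature E in
  rough_laplacian E H u =
  \sum_(i < m) curvature G (F u) (push (E i) u) (H u) (push (E i) u).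

Definition scalar_second_form (nu : 'rV[R]_n) (u v w : 'rV[R]_m) : R :=
  form (G (F u)) (second_form (cst v) (cst w) u) nu.

(* Eigenvalues with respect to the induced metric. *)
Definition principal_curvature (nu : 'rV[R]_n) (u : 'rV[R]_m) (k : R) : Prop :=
  exists2 v : 'rV[R]_m, v != 0 &
  forall w, scalar_second_form nu u v w = k * form (induced_metric u) v w.

End Submanifold.
End Coordinates.

(** * Manifolds *)

Record chart (R : realType) (n : nat) (T : topologicalType) := Chart {
  dom : set T;
  coord : T -> 'rV[R]_n;
  param : 'rV[R]_n -> T;
  dom_open : open dom;
  codom_open : open (coord @` dom);
  coordK : forall p, dom p -> param (coord p) = p;
  coord_continuous : {within dom, continuous coord};
  param_continuous : {within coord @` dom, continuous param}
}.

Record manifold (R : realType) (n : nat) (T : topologicalType) := Manifold {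
  atlas : set (chart R n T);
  atlas_cover : forall p, exists2 a, atlas a & dom a p;
  atlas_smooth : forall a b, atlas a -> atlas b ->
    smooth_on (coord a @` (dom a `&` dom b)) (coord b \o param a);
  manifold_hausdorff : hausdorff_space T;
  manifold_second_countable : @second_countable T
}.

Record riemannian_metric (R : realType) (n : nat) (T : topologicalType)
    (A : manifold R n T) := RiemannianMetric {
  metric : chart R n T -> 'rV[R]_n -> 'M[R]_n;
  metric_smooth : forall a, atlas A a ->
    smooth_on (coord a @` dom a) (metric a);
  metric_sym : forall a p, atlas A a -> dom a p ->
    (metric a (coord a p))^T = metric a (coord a p);
  metric_pos : forall a p, atlas A a -> dom a p ->
    forall v, v != 0 -> 0 < form (metric a (coord a p)) v v;
  metric_compat : forall a b p, atlas A a -> atlas A b -> dom a p -> dom b p ->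
    forall v w, form (metric a (coord a p)) v w =
      form (metric b (coord b p)) ('D_v (coord b \o param a) (coord a p))
                                  ('D_w (coord b \o param a) (coord a p))
}.

(** * Space forms *)

Section SpaceForm.
Context {R : realType} {n : nat} {N : topologicalType} {A : manifold R n N}.
Variable g : riemannian_metric A.

Definition is_geodesic (gamma : R^o -> N) : Prop :=
  continuous gamma /\
  forall b, atlas A b ->
    smooth_on (gamma @^-1` dom b) (coord b \o gamma) /\
    forall t, dom b (gamma t) ->
      cov (metric g b) (coord b \o gamma) (cst 1)
        (fun s => 'D_1 (coord b \o gamma) s) t = 0.

Definition geodesically_complete : Prop :=
  forall b p v, atlas A b -> dom b p ->
  exists gamma : R^o -> N,
    [/\ is_geodesic gamma, gamma 0 = p & 'D_1 (coord b \o gamma) 0 = v].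

Definition constant_sectional_curvature (c : R) : Prop :=
  forall b p, atlas A b -> dom b p ->
  forall v w : 'rV[R]_n, row_free (col_mx v w) ->
    sectional_curvature (metric g b) (coord b p) v w = c.

(* Complete connected, not necessarily simply connected. *)
Definition space_form (c : R) : Prop :=
  [/\ connected [set: N], geodesically_complete
    & constant_sectional_curvature c].

End SpaceForm.

(** * Immersed hypersurfaces *)

Section Immersion.
Context {R : realType} {m n : nat} {M N : topologicalType}.
Variables (AM : manifold R m M) (AN : manifold R n N).
Variable (x : M -> N).

Definition local_dom (a : chart R m M) (b : chart R n N) : set 'rV[R]_m :=
  coord a @` (dom a `&` x @^-1` dom b).

Definition local_map (a : chart R m M) (b : chart R n N) :
  'rV[R]_m -> 'rV[R]_n := coord b \o x \o param a.

Definition smooth_map : Prop :=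
  continuous x /\
  forall a b, atlas AM a -> atlas AN b ->
    smooth_on (local_dom a b) (local_map a b).

Definition immersion : Prop :=
  smooth_map /\
  forall a b u, atlas AM a -> atlas AN b -> local_dom a b u ->
    forall v, 'D_v (local_map a b) u = 0 -> v = 0.

(* [nu b p] is the row of components, in the chart b, of the value at p of a
   section of the pullback by x of the tangent bundle of N. *)
Definition vector_field_along (nu : chart R n N -> M -> 'rV[R]_n) : Prop :=
  (forall b b' p, atlas AN b -> atlas AN b' -> dom b (x p) -> dom b' (x p) ->
     nu b' p = 'D_(nu b p) (coord b' \o param b) (coord b (x p))) /\
  (forall a b, atlas AM a -> atlas AN b ->
     smooth_on (local_dom a b) (nu b \o param a)).

Variable g : riemannian_metric AN.

Definition unit_normal (nu : chart R n N -> M -> 'rV[R]_n) : Prop :=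
  forall a b p, atlas AM a -> atlas AN b -> dom a p -> dom b (x p) ->
    form (metric g b (coord b (x p))) (nu b p) (nu b p) = 1 /\
    forall v, form (metric g b (coord b (x p))) (nu b p)
                   ('D_v (local_map a b) (coord a p)) = 0.

Definition weakly_convex : Prop :=
  exists nu, [/\ vector_field_along nu, unit_normal nu &
  forall a b p, atlas AM a -> atlas AN b -> dom a p -> dom b (x p) ->
  forall k, principal_curvature (metric g b) (local_map a b) (nu b p)
              (coord a p) k -> 0 <= k].

(* Both sides of the equation do not depend on the local orthonormal frame E,
   which also serves to express the mean curvature vector. *)
Definition biharmonic : Prop :=
  forall a b u, atlas AM a -> atlas AN b -> local_dom a b u ->
  exists (W : set 'rV[R]_m) (E : 'I_m -> 'rV[R]_m -> 'rV[R]_m),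
    [/\ open W /\ W u, W `<=` local_dom a b,
        forall i, smooth_on W (E i),
        forall w, W w ->
          orthonormal_at (metric g b) (local_map a b) w (fun i => E i w)
      & forall w, W w -> biharmonic_eq (metric g b) (local_map a b) E w].

(* The mean curvature vector at u involves the frame through the tensor h
   only, so any local vector fields that are orthonormal at u will do, in
   particular a local orthonormal frame, or an orthonormal basis at u extended
   by constant components. *)
Definition minimal : Prop :=
  forall a b u, atlas AM a -> atlas AN b -> local_dom a b u ->
  forall (W : set 'rV[R]_m) (E : 'I_m -> 'rV[R]_m -> 'rV[R]_m),
    open W -> W u -> (forall i, smooth_on W (E i)) ->
    orthonormal_at (metric g b) (local_map a b) u (fun i => E i u) ->
    mean_curvature (metric g b) (local_map a b) E u = 0.

End Immersion.

(* Main.v *)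
(* Let H = f nu, where nu is the unit normal for which the hypersurface is
   weakly convex, and let A be the shape operator.  The least principal
   curvature is nonnegative, hence f >= 0.  By the Codazzi equation of a space
   form, the tangential part of the biharmonic equation is
     2 A (grad f) + m f grad f = 0,
   so that at a point where f > 0 and grad f <> 0 the negative number - m f / 2
   would be a principal curvature.  Hence grad f = 0 where f > 0; there the
   normal part of the equation reads |A|^2 = m c <= 0, so A = 0 and f = 0, a
   contradiction. *)
Require Import Defs.
From HB Require Import structures.
From mathcomp Require Import all_boot all_order all_algebra.
From mathcomp Require Import all_classical all_reals all_analysis.
From mathcomp Require Import ring lra.
(* Gives back to [form] its meaning in Defs, shadowed by that of MathComp. *)
Import Defs.

Set Implicit Arguments.
Unset Strict Implicit.
Unset Printing Implicit Defensive.

Import Order.TTheory GRing.Theory Num.Theory.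
Import numFieldNormedType.Exports.

Local Open Scope classical_set_scope.
Local Open Scope ring_scope.

(** * Smooth functions *)

(** The frame supplied by the biharmonic equation is an arbitrary orthonormal one, not a geodesic
    one, so its derivatives do not vanish at the point considered. They disappear for two reasons:
    those produced by iterating the connection cancel against the [nabla] term of the rough
    Laplacian, and those produced by differentiating the trace f pair an antisymmetric connection
    matrix with the symmetric second fundamental form. The curvature hypothesis concerns sectional
    curvatures only, while the Codazzi equation and the right-hand side of the biharmonic equation
    need the whole tensor; it is recovered from its algebraic symmetries. Likewise weak convexity
    speaks of eigenvalues only, so f >= 0 requires the existence of a real least eigenvalue,
    obtained by minimizing on a compact sphere. All conditions being local, the argument takes place
    in one pair of charts, on the open set carrying the frame. *)

Section SmoothFunctions.
Context {R : realType} {V : normedModType R}.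
Implicit Types (U : set V) (k : nat).

Lemma derive_near_eq (W : normedModType R) U (f g : V -> W) v u :
  open U -> {in U, f =1 g} -> U u -> 'D_v f u = 'D_v g u.
Proof.
move=> oU fg Uu; apply: near_eq_derive.
apply: filterS (open_nbhs_nbhs (conj oU Uu)) => y Uy; exact: fg (mem_set Uy).
Qed.

(** Only the germ at u matters: the differential of f gives a first-order expansion of g, and
    uniqueness of such an expansion identifies it with the differential of g. *)
Lemma differentiable_near_eq (W : normedModType R) U (f g : V -> W) u :
  open U -> {in U, f =1 g} -> U u -> differentiable f u -> differentiable g u.
Proof.
move=> oU fg Uu df.
have [cf Ef] := (diff_locallyP _ _).1 df.
have gE : g \o shift u = cst (g u) + 'd f u +o_ 0 id.
  have nU : \forall h \near 0, U (h + u).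
    rewrite (near_shift u 0) /=; near=> y; rewrite /= sub0r subrK.
    by near: y; exact: open_nbhs_nbhs.
  apply/eqaddoP => e e0; move/eqaddoP: Ef => /(_ e e0) Ef; near=> h.
  have Uh : U (h + u) by near: h.
  rewrite /= !fctE /= -(fg u (mem_set Uu)) -(fg _ (mem_set Uh)).
  by near: h; exact: Ef.
by apply/diff_locallyP; rewrite (diff_unique cf gE).
Unshelve. all: by end_near. Qed.

Lemma Cdiff_eq (W : normedModType R) k U (f g : V -> W) :
  open U -> {in U, f =1 g} -> Cdiff k U f -> Cdiff k U g.
Proof.
move=> oU; elim: k f g => //= k IH f g fg [df Df]; split.
  by move=> u Uu; exact: differentiable_near_eq oU fg Uu (df u Uu).
move=> v; apply: IH (Df v) => u /set_mem Uu; exact: derive_near_eq oU fg Uu.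
Qed.

Lemma smooth_eq (W : normedModType R) U (f g : V -> W) :
  open U -> {in U, f =1 g} -> smooth_on U f -> smooth_on U g.
Proof. by move=> oU fg sf k; exact: Cdiff_eq oU fg (sf k). Qed.

Lemma Cdiff_subset (W : normedModType R) k U U' (f : V -> W) :
  U' `<=` U -> Cdiff k U f -> Cdiff k U' f.
Proof.
move=> sU; elim: k f => //= k IH f [df Df]; split; first by move=> u /sU; exact: df.
by move=> v; exact: IH (Df v).
Qed.

Lemma smooth_subset (W : normedModType R) U U' (f : V -> W) :
  U' `<=` U -> smooth_on U f -> smooth_on U' f.
Proof. by move=> sU sf k; exact: Cdiff_subset sU (sf k). Qed.

Lemma smooth_differentiable (W : normedModType R) U (f : V -> W) u :
  smooth_on U f -> U u -> differentiable f u.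
Proof. by move=> /(_ 1%N) [df _]; exact: df. Qed.

Lemma smooth_derive (W : normedModType R) U (f : V -> W) v :
  smooth_on U f -> smooth_on U ('D_v f).
Proof. by move=> sf k; case: (sf k.+1) => _; exact. Qed.

Lemma smooth_cst (W : normedModType R) U (w : W) : smooth_on U (cst w).
Proof.
move=> k; elim: k w => //= k IH w; split=> [u _|v]; first exact: differentiable_cst.
by rewrite (_ : (fun u => _) = cst 0) //; apply/funext => u; rewrite derive_cst.
Qed.

Lemma Cdiff_add (W : normedModType R) k U (f g : V -> W) : open U ->
  Cdiff k U f -> Cdiff k U g -> Cdiff k U (fun u => f u + g u).
Proof.
move=> oU; elim: k f g => //= k IH f g [df Df] [dg Dg]; split.
  by move=> u Uu; apply: differentiableD; [exact: df|exact: dg].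
move=> v; apply: Cdiff_eq (IH _ _ (Df v) (Dg v)) => // u /set_mem Uu.
by rewrite -deriveD //; apply: diff_derivable; [exact: df|exact: dg].
Qed.

Lemma smooth_add (W : normedModType R) U (f g : V -> W) : open U ->
  smooth_on U f -> smooth_on U g -> smooth_on U (fun u => f u + g u).
Proof. by move=> oU sf sg k; exact: Cdiff_add. Qed.

Lemma Cdiff_opp (W : normedModType R) k U (f : V -> W) : open U ->
  Cdiff k U f -> Cdiff k U (fun u => - f u).
Proof.
move=> oU; elim: k f => //= k IH f [df Df]; split.
  by move=> u Uu; apply: differentiableN; exact: df.
move=> v; apply: Cdiff_eq (IH _ (Df v)) => // u /set_mem Uu.
by rewrite -deriveN //; apply: diff_derivable; exact: df.
Qed.

Lemma smooth_sub (W : normedModType R) U (f g : V -> W) : open U ->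
  smooth_on U f -> smooth_on U g -> smooth_on U (fun u => f u - g u).
Proof. by move=> oU sf sg k; apply: Cdiff_add => //; exact: Cdiff_opp. Qed.

Lemma Cdiff_pred (W : normedModType R) k U (f : V -> W) :
  Cdiff k.+1 U f -> Cdiff k U f.
Proof.
elim: k f => // k IH f [df Df]; split=> // v; exact: IH (Df v).
Qed.

Lemma Cdiff_mul k U (f g : V -> R) : open U ->
  Cdiff k U f -> Cdiff k U g -> Cdiff k U (fun u => f u * g u).
Proof.
move=> oU; elim: k f g => // k IH f g Sf Sg.
case: (Sf) (Sg) => [df Df] [dg Dg]; split.
  by move=> u Uu; apply: differentiableM; [exact: df|exact: dg].
move=> v; have := Cdiff_add oU (IH _ _ (Cdiff_pred Sf) (Dg v))
   (IH _ _ (Cdiff_pred Sg) (Df v)).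
apply: Cdiff_eq => // u /set_mem Uu.
by rewrite -deriveM //; apply: diff_derivable; [exact: df|exact: dg].
Qed.

Lemma smooth_mul U (f g : V -> R) : open U ->
  smooth_on U f -> smooth_on U g -> smooth_on U (fun u => f u * g u).
Proof. by move=> oU sf sg k; exact: Cdiff_mul. Qed.

Lemma smooth_scale U (a : R) (f : V -> R) : open U ->
  smooth_on U f -> smooth_on U (fun u => a * f u).
Proof. by move=> oU; apply: smooth_mul => //; exact: smooth_cst. Qed.

Lemma Cdiff_sum (W : normedModType R) k U I (r : seq I) (P : pred I) (f : I -> V -> W) :
  open U -> (forall i, P i -> Cdiff k U (f i)) ->
  Cdiff k U (fun u => \sum_(i <- r | P i) f i u).
Proof.
move=> oU sf; elim: r => [|i r IH].
  by apply: Cdiff_eq (smooth_cst U 0 k) => // u _; rewrite big_nil.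
case Pi: (P i).
  by apply: Cdiff_eq (Cdiff_add oU (sf i Pi) IH) => // u _; rewrite big_cons Pi.
by apply: Cdiff_eq IH => // u _; rewrite big_cons Pi.
Qed.

Lemma smooth_sum (W : normedModType R) U I (r : seq I) (P : pred I) (f : I -> V -> W) :
  open U -> (forall i, P i -> smooth_on U (f i)) ->
  smooth_on U (fun u => \sum_(i <- r | P i) f i u).
Proof. by move=> oU sf k; apply: Cdiff_sum => // i Pi; exact: sf. Qed.

Lemma smooth_prod U I (r : seq I) (P : pred I) (f : I -> V -> R) :
  open U -> (forall i, P i -> smooth_on U (f i)) ->
  smooth_on U (fun u => \prod_(i <- r | P i) f i u).
Proof.
move=> oU sf; elim: r => [|i r IH].
  by refine (smooth_eq oU _ (smooth_cst U (1 : R))) => u _; rewrite big_nil.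
case Pi: (P i).
  by refine (smooth_eq oU _ (smooth_mul oU (sf i Pi) IH)) => u _; rewrite big_cons Pi.
by refine (smooth_eq oU _ IH) => u _; rewrite big_cons Pi.
Qed.

Lemma smooth_inv U (f : V -> R) : open U -> (forall u, U u -> f u != 0) ->
  smooth_on U f -> smooth_on U (fun u => (f u)^-1).
Proof.
move=> oU f0 sf k; elim: k => // k IH; split.
  move=> u Uu; apply: differentiableV; last exact: f0.
  exact: smooth_differentiable sf Uu.
(* The derivative of 1/f is a product of two factors 1/f, the constant -1 and ['D_v f], so the
   induction hypothesis on 1/f at order k suffices. *)
move=> v; have := Cdiff_mul oU (Cdiff_mul oU IH IH)
   (Cdiff_mul oU (smooth_cst _ (-1 : R) k) (smooth_derive v sf k)).
apply: Cdiff_eq => // u /set_mem Uu; rewrite deriveV; first last.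
  apply: diff_derivable; exact: smooth_differentiable sf Uu.
  exact: f0.
by rewrite /cst -exprVn expr2 mulN1r scaleNr -mulrN.
Qed.

Lemma differentiable_entry p q (f : V -> 'M[R]_(p, q)) i j u :
  differentiable f u -> differentiable (fun u => f u i j : R) u.
Proof.
move=> df; apply: (@differentiable_comp _ _ _ _ f (fun N => N i j)) => //.
exact: differentiable_coord.
Qed.

Lemma derive_entry p q (f : V -> 'M[R]_(p, q)) i j u v :
  differentiable f u -> 'D_v (fun u => f u i j : R) u = 'D_v f u i j.
Proof. by move=> df; rewrite derive_mx ?mxE //; exact: diff_derivable. Qed.

Lemma differentiable_mxP p q (f : V -> 'M[R]_(p, q)) u :
  (forall i j, differentiable (fun u => f u i j : R) u) -> differentiable f u.
Proof.
move=> df; have -> : f = \sum_i \sum_j (fun u => f u i j *: delta_mx i j).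
  apply/funext => w; rewrite [LHS]matrix_sum_delta fct_sumE.
  by apply: eq_bigr => i _; rewrite fct_sumE.
apply: differentiable_sum => i; apply: differentiable_sum => j.
exact: differentiableZl.
Qed.

Lemma Cdiff_mx p q k U (f : V -> 'M[R]_(p, q)) : open U ->
  Cdiff k U f <-> forall i j, Cdiff k U (fun u => f u i j : R).
Proof.
move=> oU; elim: k f => [|k IH] f; first by split.
split=> [[df Df] i j|Sf]; split.
- by move=> u Uu; apply: differentiable_entry; exact: df.
- move=> v; apply: Cdiff_eq ((IH _).1 (Df v) i j) => // u /set_mem Uu.
  by rewrite derive_entry //; exact: df.
- by move=> u Uu; apply: differentiable_mxP => i j; case: (Sf i j) => df _; exact: df.
- move=> v; apply/IH => i j; case: (Sf i j) => df Df.
  apply: Cdiff_eq (Df v) => // u /set_mem Uu.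
  rewrite derive_entry //; apply: differentiable_mxP => i' j'.
  by case: (Sf i' j') => df' _; exact: df'.
Qed.

Lemma smooth_mxP p q U (f : V -> 'M[R]_(p, q)) : open U ->
  smooth_on U f <-> forall i j, smooth_on U (fun u => f u i j : R).
Proof.
move=> oU; split=> [Sf i j k|Sf k]; first by have /(Cdiff_mx _ _ oU) := Sf k; exact.
by apply/Cdiff_mx => // i j; exact: Sf.
Qed.

Lemma smooth_mulmx p q r U (f : V -> 'M[R]_(p, q)) (g : V -> 'M[R]_(q, r)) :
  open U -> smooth_on U f -> smooth_on U g -> smooth_on U (fun u => f u *m g u).
Proof.
move=> oU /(smooth_mxP _ oU) sf /(smooth_mxP _ oU) sg; apply/smooth_mxP => // i j.
under eq_fun do rewrite mxE.
by apply: smooth_sum => // l _; exact: smooth_mul.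
Qed.

Lemma smooth_det p U (f : V -> 'M[R]_p) :
  open U -> smooth_on U f -> smooth_on U (fun u => \det (f u)).
Proof.
move=> oU /(smooth_mxP _ oU) sf; rewrite /determinant.
apply: smooth_sum => // s _; apply: smooth_scale => //; exact: smooth_prod.
Qed.

Lemma smooth_invmx p U (f : V -> 'M[R]_p) : open U ->
  (forall u, U u -> f u \in unitmx) ->
  smooth_on U f -> smooth_on U (fun u => invmx (f u)).
Proof.
move=> oU fU sf.
(* Cramer's formula reduces the inverse to determinants, which are polynomials in the entries. *)
have E : {in U, (fun u => (\det (f u))^-1 *: \adj (f u)) =1 (fun u => invmx (f u))}.
  by move=> u /set_mem Uu; rewrite /invmx fU.
refine (smooth_eq oU E _).
apply/smooth_mxP => // i j.
under eq_fun do rewrite !mxE /cofactor.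
apply: smooth_mul => //.
  apply: smooth_inv => //; last exact: smooth_det.
  by move=> u /fU; rewrite unitmxE unitfE.
apply: smooth_scale => //; apply: smooth_det => //.
apply/smooth_mxP => // i' j'; under eq_fun do rewrite !mxE.
by move/smooth_mxP : sf; exact.
Qed.

Lemma derive_dirD (W : normedModType R) (f : V -> W) u v w :
  differentiable f u -> 'D_(v + w) f u = 'D_v f u + 'D_w f u.
Proof. by move=> df; rewrite !deriveE // linearD. Qed.

Lemma derive_dirZ (W : normedModType R) (f : V -> W) u a v :
  differentiable f u -> 'D_(a *: v) f u = a *: 'D_v f u.
Proof. by move=> df; rewrite !deriveE // linearZ. Qed.

Lemma derive_dir_sum (W : normedModType R) (f : V -> W) u I (r : seq I)
    (a : I -> R) (v : I -> V) : differentiable f u ->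
  'D_(\sum_(i <- r) a i *: v i) f u = \sum_(i <- r) a i *: 'D_(v i) f u.
Proof.
move=> df; rewrite deriveE // linear_sum; apply: eq_bigr => i _.
by rewrite linearZ deriveE.
Qed.

Lemma derive_comp (W W' : normedModType R) (F : V -> W) (g : W -> W') u v :
  differentiable F u -> differentiable g (F u) ->
  'D_v (g \o F) u = 'D_('D_v F u) g (F u).
Proof.
move=> dF dg; have dgF := differentiable_comp dF dg.
by rewrite (deriveE v dgF) (diff_comp dF dg) (deriveE v dF) (deriveE _ dg).
Qed.

End SmoothFunctions.

Section Composition.
Context {R : realType} {V : normedModType R}.

Lemma smooth_comp n (U : set V) (O : set 'rV[R]_n) (F : V -> 'rV[R]_n)
    (g : 'rV[R]_n -> R) : open U -> (forall u, U u -> O (F u)) ->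
  smooth_on U F -> smooth_on O g -> smooth_on U (g \o F).
Proof.
move=> oU UO sF sg k; elim: k g sg => // k IH g sg.
have dF u : U u -> differentiable F u by exact: smooth_differentiable.
have dg u : U u -> differentiable g (F u) by move=> /UO; exact: smooth_differentiable.
split=> [u Uu|v]; first by apply: differentiable_comp; [exact: dF|exact: dg].
(* The chain rule differentiates g in the direction ['D_v F u], which varies with u, whereas [Cdiff]
   controls derivatives in fixed directions only; hence the expansion in the standard basis. *)
pose h u := \sum_(j < n) 'D_v F u 0 j * ('D_(delta_mx 0 j) g \o F) u.
apply: (@Cdiff_eq _ _ _ _ _ h) => //.
  move=> u /set_mem Uu; rewrite derive_comp; [|exact: dF|exact: dg].
  by rewrite [in RHS](row_sum_delta ('D_v F u)) derive_dir_sum //; exact: dg.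
apply: Cdiff_sum => // j _; apply: Cdiff_mul => //.
  exact: (smooth_mxP _ oU).1 (smooth_derive v sF) 0 j k.
exact/IH/smooth_derive.
Qed.

Lemma smooth_comp_mx n p q (U : set V) (O : set 'rV[R]_n) (F : V -> 'rV[R]_n)
    (g : 'rV[R]_n -> 'M[R]_(p, q)) :
  open U -> open O -> (forall u, U u -> O (F u)) ->
  smooth_on U F -> smooth_on O g -> smooth_on U (g \o F).
Proof.
move=> oU oO UO sF /(smooth_mxP _ oO) sg; apply/(smooth_mxP _ oU) => i j.
exact: smooth_comp UO sF (sg i j).
Qed.

End Composition.

Lemma smooth_id (R : realType) (V : normedModType R) (U : set V) : smooth_on U id.
Proof.
case=> //= k; split=> [//|v].
rewrite (_ : (fun u => _) = cst v); first exact: smooth_cst.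
by apply/funext => u; rewrite derive_id.
Qed.

(** * Symmetry of second derivatives *)

Section Schwarz.
Context {R : realType} {V : normedModType R}.

Lemma line_mvt (f : V -> R) (u v : V) (h : R) : 0 < h ->
  (forall s, 0 <= s <= h -> differentiable f (u + s *: v)) ->
  exists2 s, 0 <= s <= h & f (u + h *: v) - f u = 'D_v f (u + s *: v) * h.
Proof.
move=> h0 df; pose F (s : R) := u + s *: v.
have dF s : differentiable F s.
  by rewrite (_ : F = cst u + *:%R^~ v) //; apply: differentiableD.
have DF s : 'D_1 F s = v.
  rewrite deriveE // (_ : F = cst u + *:%R^~ v) // diffD //.
  by rewrite diff_cst -[LHS]/(0 + 'd ( *:%R^~ v) s 1) add0r diff_val /= scale1r.
have dfF s : 0 <= s <= h -> differentiable (f \o F) s.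
  by move=> hs; apply: differentiable_comp => //; exact: df.
have [s| |s] := @MVT R (f \o F) (fun s => 'D_v f (F s)) 0 h h0.
- rewrite in_itv /= => /andP[s0 sh].
  have hs : 0 <= s <= h by rewrite !ltW.
  apply: DeriveDef; first by apply: diff_derivable; exact: dfF.
  by rewrite derive_comp ?DF //; exact: df.
- apply: derivable_within_continuous => s; rewrite in_itv /= => hs.
  by apply: diff_derivable; exact: dfF.
- rewrite in_itv /= => /andP[s0 sh] E; exists s; first by rewrite !ltW.
  by move: E; rewrite /F /= scale0r addr0 subr0.
Qed.

(* Two applications of the mean value theorem; exchanging v and w gives the
   symmetry of second derivatives. *)
Lemma mixed_difference (U : set V) (f : V -> R) (u v w : V) (h : R) : 0 < h ->
  smooth_on U f ->
  (forall s t, 0 <= s <= h -> 0 <= t <= h -> U (u + s *: v + t *: w)) ->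
  exists s t, [/\ 0 <= s <= h, 0 <= t <= h &
    f (u + h *: v + h *: w) - f (u + h *: v) - (f (u + h *: w) - f u) =
    'D_w ('D_v f) (u + s *: v + t *: w) * h * h].
Proof.
move=> h0 sf Uuvw.
have hh : 0 <= h <= h by rewrite ltW /=.
have h00 : (0 : R) <= 0 <= h by rewrite lexx ltW.
have U0 s : 0 <= s <= h -> U (u + s *: v).
  by move=> hs; rewrite -[_ + _]addr0 -(scale0r w); exact: Uuvw.
have df s : 0 <= s <= h -> differentiable f (u + s *: v).
  by move=> /U0; exact: smooth_differentiable.
pose S x := x + h *: w.
have dS x : differentiable S x.
  by rewrite (_ : S = id + cst (h *: w)) //; apply: differentiableD.
have DS x a : 'D_a S x = a.
  rewrite deriveE // (_ : S = id + cst (h *: w)) // diffD //.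
  by rewrite diff_cst -[LHS]/('d id x a + 0) addr0 diff_val.
have dfS s : 0 <= s <= h -> differentiable f (S (u + s *: v)).
  by move=> hs; apply: smooth_differentiable sf _; exact: Uuvw.
have dfSc s : 0 <= s <= h -> differentiable (f \o S) (u + s *: v).
  by move=> hs; apply: differentiable_comp => //; exact: dfS.
have [s hs] : exists2 s, 0 <= s <= h &
    (f \o S - f) (u + h *: v) - (f \o S - f) u = 'D_v (f \o S - f) (u + s *: v) * h.
  by apply: line_mvt => // s hs; apply: differentiableB; [exact: dfSc|exact: df].
rewrite deriveB; [|by apply: diff_derivable; exact: dfSc|by apply: diff_derivable; exact: df].
rewrite derive_comp ?DS //; last exact: dfS.
rewrite !fctE /= /S => ->.
have [t ht] : exists2 t, 0 <= t <= h & 'D_v f (u + s *: v + h *: w) -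
   'D_v f (u + s *: v) = 'D_w ('D_v f) (u + s *: v + t *: w) * h.
  apply: (@line_mvt ('D_v f) (u + s *: v) w h h0) => t ht.
  by apply: (smooth_differentiable (smooth_derive v sf)); exact: Uuvw.
by move=> ->; exists s, t.
Qed.

(** By [mixed_difference] the same second difference over a small parallelogram is h * h times a
    value of either mixed derivative at a nearby point. If the two differed at u, continuity would
    keep these values apart, each within half of the gap from its own limit. *)
Lemma derive_comm (U : set V) (f : V -> R) u v w : open U -> U u ->
  smooth_on U f -> 'D_v ('D_w f) u = 'D_w ('D_v f) u.
Proof.
move=> oU Uu sf; apply/eqP; rewrite -subr_eq0 -normr_le0 leNgt; apply/negP.
set A := 'D_v _ u; set B := 'D_w _ u => AB0.
have cA : {for u, continuous ('D_v ('D_w f))}.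
  apply: differentiable_continuous.
  exact: smooth_differentiable (smooth_derive v (smooth_derive w sf)) Uu.
have cB : {for u, continuous ('D_w ('D_v f))}.
  apply: differentiable_continuous.
  exact: smooth_differentiable (smooth_derive w (smooth_derive v sf)) Uu.
pose e := `|A - B| / 2.
have e0 : 0 < e by rewrite divr_gt0.
move/cvgrPdist_lt : cA => /(_ e e0) cA.
move/cvgrPdist_lt : cB => /(_ e e0) cB.
have /nbhs_ballP[r /= r0 rP] : nbhs u (fun y => [/\ U y, `|A - 'D_v ('D_w f) y| < e
    & `|B - 'D_w ('D_v f) y| < e]).
  have nU : nbhs u U by exact: open_nbhs_nbhs.
  apply: (filterS _ (filterI nU (filterI cA cB))) => y [Uy [Ay By]].
  refine (And3 Uy Ay By).
have tri (a b y : R) : `|a - y| < `|a - b| / 2 -> `|b - y| < `|a - b| / 2 -> False.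
  move=> ay yb; have := ltrD ay yb; rewrite -splitr ltNge => /negP; apply.
  by rewrite (distrC b) -(subrKA y a (- b)) ler_normD.
(* With this h the parallelogram of sides h v and h w stays in the ball of radius r; the 1 keeps the
   denominator positive when v = w = 0. *)
pose h := r / (1 + `|v| + `|w|).
have n0 : 0 < 1 + `|v| + `|w| by rewrite -addrA ltr_pwDl.
have h0 : 0 < h by rewrite divr_gt0.
have inb s t : 0 <= s <= h -> 0 <= t <= h -> ball u r (u + s *: v + t *: w).
  move=> /andP[s0 sh] /andP[t0 th]; rewrite -ball_normE /= -addrA opprD addNKr normrN.
  apply: le_lt_trans (ler_normD _ _) _; rewrite !normrZ !ger0_norm //.
  apply: (@le_lt_trans _ _ (h * `|v| + h * `|w|)).
    by rewrite lerD // ler_wpM2r.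
  rewrite -mulrDr /h mulrAC ltr_pdivrMr // ltr_pM2l //.
  by rewrite -addrA ltrDr.
have [s [t [hs ht E1]]] := mixed_difference h0 sf
  (fun s t hs ht => let: And3 Us _ _ := rP _ (inb s t hs ht) in Us).
have inb' s' t' : 0 <= s' <= h -> 0 <= t' <= h -> ball u r (u + s' *: w + t' *: v).
  by move=> hs' ht'; rewrite addrAC; exact: inb.
have [s' [t' [hs' ht' E2]]] := mixed_difference h0 sf
  (fun s t hs ht => let: And3 Us _ _ := rP _ (inb' s t hs ht) in Us).
have E3 : 'D_w ('D_v f) (u + s *: v + t *: w) = 'D_v ('D_w f) (u + s' *: w + t' *: v).
  have hN : h != 0 by rewrite gt_eqF.
  apply: (mulIf hN); apply: (mulIf hN); refine (etrans (esym E1) (etrans _ E2)).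
  by rewrite (addrAC u (h *: w)); ring.
have [_ _ B1] := rP _ (inb _ _ hs ht).
have [_ A1 _] := rP _ (inb' _ _ hs' ht').
by rewrite E3 in B1; exact: tri A1 B1.
Qed.

Lemma derive_comm_mx p q (U : set V) (f : V -> 'M[R]_(p, q)) u v w :
  open U -> U u -> smooth_on U f -> 'D_v ('D_w f) u = 'D_w ('D_v f) u.
Proof.
move=> oU Uu sf; apply/matrixP => i j.
have E a b : 'D_a ('D_b f) u i j = 'D_a ('D_b (fun y => f y i j : R)) u.
  rewrite -derive_entry; last exact: smooth_differentiable (smooth_derive b sf) Uu.
  apply: derive_near_eq oU _ Uu => y /set_mem Uy.
  by rewrite derive_entry //; exact: smooth_differentiable sf Uy.
refine (etrans (E v w) (etrans _ (esym (E w v)))).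
refine (@derive_comm U _ u v w oU Uu _).
exact: ((smooth_mxP f oU).1 sf i j).
Qed.

End Schwarz.

(* Otherwise comparing two iterated derivatives unfolds them without end. For
   the same reason, algebraic identities between derivatives are applied below
   as lemmas on arbitrary elements instead of being left to [ring]. *)
#[local] Opaque derive.

(** * Product rules for matrices and bilinear forms *)

Section ProductRules.
Context {R : realType} {V : normedModType R}.

Lemma derive_sumE (W : normedModType R) n (f : 'I_n -> V -> W) u v :
  (forall i, differentiable (f i) u) ->
  'D_v (fun u => \sum_(i < n) f i u) u = \sum_(i < n) 'D_v (f i) u.
Proof.
move=> df; rewrite -derive_sum; last by move=> i; exact: diff_derivable.
by congr ('D_v _ u); apply/funext => w; rewrite fct_sumE.
Qed.

Lemma derive_addE (W : normedModType R) (f g : V -> W) u v :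
  differentiable f u -> differentiable g u ->
  'D_v (fun u => f u + g u) u = 'D_v f u + 'D_v g u.
Proof. by move=> df dg; rewrite -deriveD //; exact: diff_derivable. Qed.

Lemma derive_oppE (W : normedModType R) (f : V -> W) u v :
  differentiable f u -> 'D_v (fun u => - f u) u = - 'D_v f u.
Proof. by move=> df; rewrite -deriveN //; exact: diff_derivable. Qed.

Lemma derive_scaleE (W : normedModType R) (f : V -> W) c u v :
  differentiable f u -> 'D_v (fun u => c *: f u) u = c *: 'D_v f u.
Proof. by move=> df; rewrite -deriveZ //; exact: diff_derivable. Qed.

Lemma derive_mulE (f g : V -> R) u v :
  differentiable f u -> differentiable g u ->
  'D_v (fun u => f u * g u) u = 'D_v f u * g u + f u * 'D_v g u.
Proof.
have dd (h : V -> R) : differentiable h u -> derivable h u v by exact: diff_derivable.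
move=> df dg; have := deriveM (dd _ df) (dd _ dg).
by rewrite addrC [g u *: _]mulrC.
Qed.

Lemma derive_mulrE (f : V -> R) c u v :
  differentiable f u -> 'D_v (fun u => c * f u) u = c * 'D_v f u.
Proof. by move=> df; rewrite derive_mulE // derive_cst mul0r add0r. Qed.

Lemma differentiable_mul (f g : V -> R) u :
  differentiable f u -> differentiable g u -> differentiable (fun u => f u * g u) u.
Proof. exact: differentiableM. Qed.

Lemma differentiable_sumE (W : normedModType R) n (f : 'I_n -> V -> W) u :
  (forall i, differentiable (f i) u) ->
  differentiable (fun u => \sum_(i < n) f i u) u.
Proof.
move=> df; rewrite (_ : (fun u => _) = \sum_(i < n) f i).
  exact: differentiable_sum.
by apply/funext => w; rewrite fct_sumE.
Qed.

Lemma derive_mulmx p q r (f : V -> 'M[R]_(p, q)) (g : V -> 'M[R]_(q, r)) u v :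
  differentiable f u -> differentiable g u ->
  differentiable (fun u => f u *m g u) u /\
  'D_v (fun u => f u *m g u) u = 'D_v f u *m g u + f u *m 'D_v g u.
Proof.
move=> df dg.
have dfg i j : differentiable (fun w => (f w *m g w) i j : R) u.
  under eq_fun do rewrite mxE.
  by apply: differentiable_sumE => l; apply: differentiable_mul; apply: differentiable_entry.
have dm : differentiable (fun u => f u *m g u) u by exact: differentiable_mxP.
split => //; apply/matrixP => i j; rewrite -derive_entry //.
under eq_fun do rewrite mxE.
rewrite derive_sumE => [|l]; last by apply: differentiable_mul; apply: differentiable_entry.
rewrite !mxE -big_split; apply: eq_bigr => l _ /=.
by rewrite derive_mulE; [rewrite !derive_entry| |]; try apply: differentiable_entry.
Qed.

Lemma derive_trmx p q (f : V -> 'M[R]_(p, q)) u v :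
  differentiable f u ->
  differentiable (fun u => (f u)^T) u /\ 'D_v (fun u => (f u)^T) u = ('D_v f u)^T.
Proof.
move=> df; have dft : differentiable (fun u => (f u)^T) u.
  apply: differentiable_mxP => i j; under eq_fun do rewrite mxE.
  exact: differentiable_entry.
split => //; apply/matrixP => i j; rewrite -derive_entry // mxE -derive_entry //.
by under eq_fun do rewrite mxE.
Qed.

Lemma smooth_trmx p q U (f : V -> 'M[R]_(p, q)) : open U ->
  smooth_on U f -> smooth_on U (fun u => (f u)^T).
Proof.
move=> oU /(smooth_mxP _ oU) sf; apply/(smooth_mxP _ oU) => i j.
by under eq_fun do rewrite mxE; exact: sf.
Qed.

Lemma derive_form n (A : V -> 'M[R]_n) (X Y : V -> 'rV[R]_n) u v :
  differentiable A u -> differentiable X u -> differentiable Y u ->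
  'D_v (fun u => form (A u) (X u) (Y u)) u =
  form ('D_v A u) (X u) (Y u) + form (A u) ('D_v X u) (Y u)
  + form (A u) (X u) ('D_v Y u).
Proof.
move=> dA dX dY; rewrite /form.
have [dYt DYt] := derive_trmx v dY.
have [dXA DXA] := derive_mulmx v dX dA.
have [d D] := derive_mulmx v dXA dYt.
rewrite derive_entry // D DXA DYt !mulmxDl !mxE; ring.
Qed.

Lemma smooth_form n U (A : V -> 'M[R]_n) (X Y : V -> 'rV[R]_n) : open U ->
  smooth_on U A -> smooth_on U X -> smooth_on U Y ->
  smooth_on U (fun u => form (A u) (X u) (Y u)).
Proof.
move=> oU sA sX sY; rewrite /form.
apply: (smooth_mxP _ oU).1 => //; apply: smooth_mulmx => //.
  exact: smooth_mulmx.
exact: smooth_trmx.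
Qed.

Lemma smooth_scaled_field p q U (k : V -> R) (X : V -> 'M[R]_(p, q)) : open U ->
  smooth_on U k -> smooth_on U X -> smooth_on U (fun u => k u *: X u).
Proof.
move=> oU sk sX; apply/(smooth_mxP _ oU) => i j.
have := smooth_mul oU sk ((smooth_mxP _ oU).1 sX i j).
by apply: smooth_eq => // u _; rewrite mxE.
Qed.

End ProductRules.

(** A predicate rather than a bundled structure: maps such as [christoffel G y] are known to be
    bilinear only for y in the domain of the metric. *)
Definition bilin {R : realType} {p q : nat} (W : lmodType R)
    (T : 'rV[R]_p -> 'rV[R]_q -> W) :=
  (forall w, linear (T ^~ w)) /\ (forall v, linear (T v)).

Section Bilinear.
Context {R : realType}.

Lemma bilinDl p q (W : lmodType R) (T : 'rV[R]_p -> 'rV[R]_q -> W) v v' w :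
  bilin T -> T (v + v') w = T v w + T v' w.
Proof. by case=> /(_ w 1 v v'); rewrite !scale1r. Qed.

Lemma bilinDr p q (W : lmodType R) (T : 'rV[R]_p -> 'rV[R]_q -> W) v w w' :
  bilin T -> T v (w + w') = T v w + T v w'.
Proof. by case=> _ /(_ v 1 w w'); rewrite !scale1r. Qed.

Lemma bilin0l p q (W : lmodType R) (T : 'rV[R]_p -> 'rV[R]_q -> W) w :
  bilin T -> T 0 w = 0.
Proof. by move=> bT; apply: (addrI (T 0 w)); rewrite -bilinDl // !addr0. Qed.

Lemma bilin0r p q (W : lmodType R) (T : 'rV[R]_p -> 'rV[R]_q -> W) v :
  bilin T -> T v 0 = 0.
Proof. by move=> bT; apply: (addrI (T v 0)); rewrite -bilinDr // !addr0. Qed.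

Lemma bilinZl p q (W : lmodType R) (T : 'rV[R]_p -> 'rV[R]_q -> W) a v w :
  bilin T -> T (a *: v) w = a *: T v w.
Proof. by move=> bT; have /(_ w a v 0) := bT.1; rewrite !addr0 bilin0l // addr0. Qed.

Lemma bilinZr p q (W : lmodType R) (T : 'rV[R]_p -> 'rV[R]_q -> W) a v w :
  bilin T -> T v (a *: w) = a *: T v w.
Proof. by move=> bT; have /(_ v a w 0) := bT.2; rewrite !addr0 bilin0r // addr0. Qed.

Lemma bilin_suml p q (W : lmodType R) (T : 'rV[R]_p -> 'rV[R]_q -> W) I
    (r : seq I) P (v : I -> 'rV[R]_p) w : bilin T ->
  T (\sum_(i <- r | P i) v i) w = \sum_(i <- r | P i) T (v i) w.
Proof.
move=> bT; elim/big_rec2 : _ => [|i y z _ <-]; first exact: bilin0l.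
exact: bilinDl.
Qed.

Lemma bilin_sumr p q (W : lmodType R) (T : 'rV[R]_p -> 'rV[R]_q -> W) I
    (r : seq I) P v (w : I -> 'rV[R]_q) : bilin T ->
  T v (\sum_(i <- r | P i) w i) = \sum_(i <- r | P i) T v (w i).
Proof.
move=> bT; elim/big_rec2 : _ => [|i y z _ <-]; first exact: bilin0r.
exact: bilinDr.
Qed.

Lemma bilin_delta p q (W : lmodType R) (T : 'rV[R]_p -> 'rV[R]_q -> W) v w :
  bilin T -> T v w =
  \sum_i \sum_j (v 0 i * w 0 j) *: T (delta_mx 0 i) (delta_mx 0 j).
Proof.
move=> bT; rewrite {1}(row_sum_delta v) bilin_suml //; apply: eq_bigr => i _.
rewrite bilinZl // {1}(row_sum_delta w) bilin_sumr // scaler_sumr.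
by apply: eq_bigr => j _; rewrite bilinZr // scalerA.
Qed.

Lemma form_bilin n (A : 'M[R]_n) : bilin (form A : _ -> _ -> R^o).
Proof.
split=> [w|v] a x y; rewrite /form.
  by rewrite !mulmxDl -!scalemxAl !mxE.
by rewrite linearP /= !mulmxDr -!scalemxAr !mxE.
Qed.

End Bilinear.

(** * Derivatives of bilinear maps that depend on a point *)

Section BilinearField.
Context {R : realType} {V : normedModType R} {n p q : nat}.
Variables (U : set V) (O : set 'rV[R]_n).
Hypotheses (oU : open U) (oO : open O).
Variables (F : V -> 'rV[R]_n) (X : V -> 'rV[R]_p) (Z : V -> 'rV[R]_q).
Hypotheses (UO : forall u, U u -> O (F u)).
Hypotheses (sF : smooth_on U F) (sX : smooth_on U X) (sZ : smooth_on U Z).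

Section Scalar.
Variable T : 'rV[R]_n -> 'rV[R]_p -> 'rV[R]_q -> R.
Hypothesis bT : forall y, O y -> bilin (T y : _ -> _ -> R^o).
Hypothesis sT : forall v w, smooth_on O (fun y => T y v w).

Let c u i j := X u 0 i * Z u 0 j.
Let t i j y := T y (delta_mx 0 i) (delta_mx 0 j).
(** [sT] gives smoothness for fixed arguments only. Expanding T in the standard basis makes it a
    finite sum of products of scalar functions, to which the usual product rule applies. *)
Let P u := \sum_i \sum_j c u i j * t i j (F u).

Let PE : {in U, P =1 fun u => T (F u) (X u) (Z u)}.
Proof. by move=> u /set_mem /UO OF; rewrite [RHS](bilin_delta _ _ (bT OF)). Qed.

Let sc i j : smooth_on U (fun u => c u i j).
Proof. by apply: smooth_mul => //; apply: (smooth_mxP _ oU).1. Qed.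

Let stF i j : smooth_on U (fun u => t i j (F u)).
Proof. exact: smooth_comp oU UO sF (sT _ _). Qed.

Lemma smooth_bilin : smooth_on U (fun u => T (F u) (X u) (Z u)).
Proof.
refine (smooth_eq oU PE _); apply: smooth_sum => // i _.
by apply: smooth_sum => // j _; apply: smooth_mul.
Qed.

Lemma derive_bilin u v : U u ->
  'D_v (fun u => T (F u) (X u) (Z u)) u =
  'D_('D_v F u) (fun y => T y (X u) (Z u)) (F u)
  + T (F u) ('D_v X u) (Z u) + T (F u) (X u) ('D_v Z u).
Proof.
move=> Uu; have OF := UO Uu.
have -> : 'D_v (fun u => T (F u) (X u) (Z u)) u = 'D_v P u.
  by apply/esym; exact: derive_near_eq oU PE Uu.
(* [Q] is [P] with the coefficients frozen at u, as in a derivative of T with respect to the base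
   point alone. *)
pose Q y := \sum_i \sum_j c u i j * t i j y.
have -> : 'D_('D_v F u) (fun y => T y (X u) (Z u)) (F u) = 'D_('D_v F u) Q (F u).
  apply: derive_near_eq oO _ OF => y /set_mem Oy.
  by rewrite [LHS](bilin_delta _ _ (bT Oy)).
rewrite !(bilin_delta _ _ (bT OF)).
have dt i j : differentiable (t i j) (F u) by exact: smooth_differentiable (sT _ _) OF.
have dc i j : differentiable (fun u => c u i j) u by exact: smooth_differentiable (sc i j) Uu.
have dtF i j : differentiable (fun u => t i j (F u)) u.
  exact: smooth_differentiable (stF i j) Uu.
have dX i : differentiable (fun u => X u 0 i : R) u.
  by apply: differentiable_entry; exact: smooth_differentiable sX Uu.
have dZ i : differentiable (fun u => Z u 0 i : R) u.
  by apply: differentiable_entry; exact: smooth_differentiable sZ Uu.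
rewrite /P /Q derive_sumE; last first.
  by move=> i; apply: differentiable_sumE => j; exact: differentiable_mul.
rewrite derive_sumE; last first.
  by move=> i; apply: differentiable_sumE => j; apply: differentiable_mul.
rewrite -!big_split; apply: eq_bigr => i _ /=.
rewrite derive_sumE; last by move=> j; exact: differentiable_mul.
rewrite derive_sumE; last by move=> j; apply: differentiable_mul.
rewrite -!big_split; apply: eq_bigr => j _ /=.
rewrite (derive_mulE _ (dc i j) (dtF i j)) (derive_mulrE _ _ (dt i j)).
rewrite (derive_mulE _ (dX i) (dZ j)) -!derive_entry; first last.
- exact: smooth_differentiable sX Uu.
- exact: smooth_differentiable sZ Uu.
have -> : 'D_v (fun u => t i j (F u)) u = 'D_('D_v F u) (t i j) (F u).
  apply: (derive_comp (F := F) (g := t i j)) => //.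
  exact: smooth_differentiable sF Uu.
rewrite /t; set d := derive _ _ _; rewrite -![_ *: _]/(_ * _).
set T0 := T (F u) _ _; rewrite /c; ring.
Qed.

End Scalar.

Section Matrix.
Context {r s : nat}.
Variable T : 'rV[R]_n -> 'rV[R]_p -> 'rV[R]_q -> 'M[R]_(r, s).
Hypothesis bT : forall y, O y -> bilin (T y).
Hypothesis sT : forall v w, smooth_on O (fun y => T y v w).

Let bTS i j y : O y -> bilin ((fun v w => T y v w i j) : _ -> _ -> R^o).
Proof.
move=> Oy; split=> [w|v] a x z.
  by rewrite /= (bT Oy).1 !mxE.
by rewrite (bT Oy).2 !mxE.
Qed.

Let sTS i j v w : smooth_on O (fun y => T y v w i j).
Proof. exact: (smooth_mxP _ oO).1. Qed.

Lemma smooth_bilin_mx : smooth_on U (fun u => T (F u) (X u) (Z u)).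
Proof.
apply/(smooth_mxP _ oU) => i j.
by apply: (@smooth_bilin (fun y v w => T y v w i j)); [exact: bTS|exact: sTS].
Qed.

Lemma derive_bilin_mx u v : U u ->
  'D_v (fun u => T (F u) (X u) (Z u)) u =
  'D_('D_v F u) (fun y => T y (X u) (Z u)) (F u)
  + T (F u) ('D_v X u) (Z u) + T (F u) (X u) ('D_v Z u).
Proof.
move=> Uu; apply/matrixP => i j; rewrite -derive_entry; last first.
  exact: smooth_differentiable smooth_bilin_mx Uu.
rewrite (@derive_bilin (fun y v w => T y v w i j) (@bTS i j) (@sTS i j)) //.
rewrite derive_entry ?mxE //.
exact: smooth_differentiable (sT _ _) (UO Uu).
Qed.

End Matrix.
End BilinearField.

(** * Linear algebra *)

Section Form.
Context {R : realType} {n : nat}.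
Implicit Types (A : 'M[R]_n) (v w : 'rV[R]_n).

Lemma formDl A v v' w : form A (v + v') w = form A v w + form A v' w.
Proof. exact: (bilinDl _ _ _ (form_bilin A)). Qed.
Lemma formDr A v w w' : form A v (w + w') = form A v w + form A v w'.
Proof. exact: (bilinDr _ _ _ (form_bilin A)). Qed.
Lemma formZl A a v w : form A (a *: v) w = a * form A v w.
Proof. exact: (bilinZl _ _ _ (form_bilin A)). Qed.
Lemma formZr A a v w : form A v (a *: w) = a * form A v w.
Proof. exact: (bilinZr _ _ _ (form_bilin A)). Qed.
Lemma form0l A w : form A 0 w = 0.
Proof. exact: (bilin0l _ (form_bilin A)). Qed.
Lemma form0r A v : form A v 0 = 0.
Proof. exact: (bilin0r _ (form_bilin A)). Qed.
Lemma formNl A v w : form A (- v) w = - form A v w.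
Proof. by rewrite -scaleN1r formZl mulN1r. Qed.
Lemma formNr A v w : form A v (- w) = - form A v w.
Proof. by rewrite -scaleN1r formZr mulN1r. Qed.
Lemma formBl A v v' w : form A (v - v') w = form A v w - form A v' w.
Proof. by rewrite formDl formNl. Qed.
Lemma formBr A v w w' : form A v (w - w') = form A v w - form A v w'.
Proof. by rewrite formDr formNr. Qed.
Lemma form_suml A I (r : seq I) (P : pred I) (v : I -> 'rV[R]_n) w :
  form A (\sum_(i <- r | P i) v i) w = \sum_(i <- r | P i) form A (v i) w.
Proof. exact: (bilin_suml _ _ _ _ (form_bilin A)). Qed.
Lemma form_sumr A I (r : seq I) (P : pred I) v (w : I -> 'rV[R]_n) :
  form A v (\sum_(i <- r | P i) w i) = \sum_(i <- r | P i) form A v (w i).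
Proof. exact: (bilin_sumr _ _ _ _ (form_bilin A)). Qed.

Lemma formMD A B v w : form (A + B) v w = form A v w + form B v w.
Proof. by rewrite /form mulmxDr mulmxDl mxE. Qed.
Lemma formMZ a A v w : form (a *: A) v w = a * form A v w.
Proof. by rewrite /form -scalemxAr -scalemxAl mxE. Qed.

Lemma form_tr A v w : form A^T v w = form A w v.
Proof.
have E : v *m A^T *m w^T = (w *m A *m v^T)^T by rewrite !trmx_mul trmxK mulmxA.
by rewrite /form E mxE.
Qed.

Lemma formC A v w : A^T = A -> form A v w = form A w v.
Proof. by move=> sA; rewrite -form_tr sA. Qed.

Lemma form_mul0 A v w : v *m A = 0 -> form A v w = 0.
Proof. by rewrite /form => ->; rewrite mul0mx mxE. Qed.

Lemma form_delta A i j : form A (delta_mx 0 i) (delta_mx 0 j) = A i j.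
Proof. by rewrite /form -rowE trmx_delta -colE !mxE. Qed.

Lemma form_invmx A (r v : 'rV[R]_n) : A \in unitmx ->
  form A (r *m invmx A) v = \sum_l v 0 l * r 0 l.
Proof.
move=> uA; rewrite /form -(mulmxA _ (invmx _)) mulVmx // mulmx1 mxE.
by apply: eq_bigr => l _; rewrite mxE mulrC.
Qed.

Lemma form_delta_sum A v w :
  form A v w = \sum_l w 0 l * form A v (delta_mx 0 l).
Proof.
rewrite {1}(row_sum_delta w) form_sumr; apply: eq_bigr => l _.
by rewrite formZr.
Qed.

Lemma formM_sum I (r : seq I) (a : I -> R) (A : I -> 'M[R]_n) v w :
  form (\sum_(i <- r) a i *: A i) v w = \sum_(i <- r) a i * form (A i) v w.
Proof.
elim/big_rec2 : _ => [|i x B _ IH]; first by rewrite /form mulmx0 mul0mx mxE.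
by rewrite formMD formMZ IH.
Qed.

(** The algebra behind lowering the index of the Christoffel symbols: A, B and C l stand for the
    derivatives of the metric M along v, w and the l-th basis vector. *)
Lemma form_koszul M A B (C : 'I_n -> 'M[R]_n) v w z : M \in unitmx ->
  form M (\row_l (form A w (delta_mx 0 l) + form B v (delta_mx 0 l)
                  - form (C l) v w) *m invmx M) z =
  form A w z + form B v z - form (\sum_l z 0 l *: C l) v w.
Proof.
move=> uM; rewrite form_invmx // formM_sum (form_delta_sum A) (form_delta_sum B).
by rewrite -big_split -sumrB; apply: eq_bigr => l _ /=; rewrite mxE; ring.
Qed.

Lemma form_koszul_linear A A' B C a v v' w z :
  form (a *: A + A') w z + form B (a *: v + v') z - form C (a *: v + v') w =
  a * (form A w z + form B v z - form C v w)
  + (form A' w z + form B v' z - form C v' w).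
Proof. by rewrite formMD formMZ !formDl !formZl; ring. Qed.

Lemma form_koszulC A B C v w z : C^T = C ->
  form A w z + form B v z - form C v w = form B v z + form A w z - form C w v.
Proof. by move=> sC; rewrite (formC v w sC); ring. Qed.

End Form.


Section Orthonormal.
Context {R : realType} {m : nat}.
Implicit Types (A : 'M[R]_m) (e : 'I_m -> 'rV[R]_m).

Definition orthonormal A e := forall i j, form A (e i) (e j) = (i == j)%:R.

(** For square matrices a right inverse is a left inverse: with E the matrix of rows e i,
    orthonormality reads E (A E^T) = 1, so (A E^T) E = 1, and v is recovered from its products with
    the e i. *)
Lemma orthonormal_expand A e v : orthonormal A e ->
  v = \sum_i form A v (e i) *: e i.
Proof.
move=> oe; pose E := \matrix_i e i.
have EAE : E *m (A *m E^T) = 1%:M.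
  apply/matrixP => i j; rewrite [RHS]mxE -oe.
  have -> : form A (e i) (e j) = (row i E *m A *m (row j E)^T) 0 0.
    by rewrite /form !rowK.
  rewrite mulmxA [LHS]mxE [RHS]mxE; apply: eq_bigr => k _.
  by rewrite -row_mul [row _ _ _ _]mxE [_^T _ _]mxE [(row _ _)^T _ _]mxE [row _ _ _ _]mxE.
have := mulmx1C EAE => AEE.
rewrite -[LHS]mulmx1 -AEE mulmxA mulmx_sum_row; apply: eq_bigr => i _.
rewrite rowK; congr (_ *: _).
have -> : form A v (e i) = (v *m A *m (row i E)^T) 0 0 by rewrite /form rowK.
rewrite mulmxA [LHS]mxE [RHS]mxE; apply: eq_bigr => k _.
by rewrite [_^T _ _]mxE [(row _ _)^T _ _]mxE [row _ _ _ _]mxE.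
Qed.

(** The matrix of a change of orthonormal frame is orthogonal. Applied to the second fundamental
    form, this makes the mean curvature vector independent of the frame. *)
Lemma orthonormal_trace (W : lmodType R) A e e' (T : 'rV[R]_m -> 'rV[R]_m -> W) :
  A^T = A -> bilin T -> orthonormal A e -> orthonormal A e' ->
  \sum_i T (e' i) (e' i) = \sum_i T (e i) (e i).
Proof.
move=> sA bT oe oe'.
have -> : \sum_i T (e' i) (e' i) =
    \sum_i \sum_j \sum_k (form A (e' i) (e j) * form A (e' i) (e k)) *: T (e j) (e k).
  apply: eq_bigr => i _; rewrite {1 2}(orthonormal_expand (e' i) oe).
  rewrite bilin_suml //; apply: eq_bigr => j _.
  rewrite bilinZl // bilin_sumr // scaler_sumr; apply: eq_bigr => k _.
  by rewrite bilinZr // scalerA.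
have aa j k : \sum_i form A (e' i) (e j) * form A (e' i) (e k) = (j == k)%:R.
  rewrite -oe [X in form A X _](orthonormal_expand (e j) oe') form_suml.
  by apply: eq_bigr => i _; rewrite formZl (formC (e j) (e' i) sA).
rewrite exchange_big; apply: eq_bigr => j _; rewrite exchange_big /=.
under eq_bigr => k _ do rewrite -scaler_suml aa.
rewrite (bigD1 j) //= eqxx scale1r big1 ?addr0 // => k kj.
by rewrite eq_sym (negPf kj) scale0r.
Qed.

End Orthonormal.

Section NormalDirection.
Context {R : realType} {m : nat}.

(* nu and the rows of J form a basis of the ambient space. *)
Lemma normal_direction (A : 'M[R]_m.+1) (J : 'M[R]_(m, m.+1)) nu h :
  (forall v, v != 0 -> 0 < form A v v) ->
  (forall v : 'rV[R]_m, v *m J = 0 -> v = 0) ->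
  form A nu nu = 1 -> (forall v, form A nu (v *m J) = 0) ->
  (forall v, form A (v *m J) nu = 0) ->
  (forall v, form A h (v *m J) = 0) ->
  h = form A h nu *: nu.
Proof.
move=> pA iJ nu1 nuJ Jnu hJ; apply/eqP; rewrite -subr_eq0; set x := h - _; apply/eqP.
have xJ v : form A x (v *m J) = 0 by rewrite formBl formZl nuJ hJ mulr0 subr0.
have xnu : form A x nu = 0 by rewrite formBl formZl nu1 mulr1 subrr.
pose M : 'M[R]_(1 + m, 1 + m) := col_mx nu J.
have rfM : row_free M.
  apply: inj_row_free => u; rewrite -[u]hsubmxK mul_row_col => E.
  rewrite (mx11_scalar (lsubmx u)) mul_scalar_mx in E *.
  have a0 : lsubmx u 0 0 = 0.
    have := congr1 (form A ^~ nu) E.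
    by rewrite formDl formZl nu1 mulr1 Jnu addr0 form0l.
  move: E; rewrite a0 scale0r add0r => /iJ ->.
  by rewrite raddf0 row_mx0.
have /submxP[D xD] : (x <= M)%MS by apply: submx_full; rewrite row_full_unit -row_free_unit.
apply/eqP/negP => /negP x0; have := pA x x0.
rewrite {2}xD -[D]hsubmxK mul_row_col (mx11_scalar (lsubmx D)) mul_scalar_mx.
by rewrite formDr formZr xnu xJ mulr0 addr0 ltxx.
Qed.

End NormalDirection.

Section MinimalEigenvalue.
Context {R : realType} {m : nat}.
Implicit Types (S : 'M[R]_m) (v w : 'rV[R]_m).

Lemma form1E v : form 1%:M v v = \sum_i v 0 i ^+ 2.
Proof. by rewrite /form mulmx1 mxE; apply: eq_bigr => i _; rewrite mxE. Qed.

Lemma form1_delta v j : form 1%:M v (delta_mx 0 j) = v 0 j.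
Proof. by rewrite /form mulmx1 trmx_delta -colE mxE. Qed.

Lemma form1_gt0 v : v != 0 -> 0 < form 1%:M v v.
Proof.
move=> v0; rewrite form1E lt_def sumr_ge0 => [|i _]; last exact: sqr_ge0.
rewrite andbT; apply: contra v0; rewrite psumr_eq0 => [/allP E|i _]; last exact: sqr_ge0.
apply/eqP/rowP => i; have := E i (mem_index_enum _).
by rewrite /= sqrf_eq0 => /eqP ->; rewrite mxE.
Qed.

(* A minimum of the quadratic form on the unit sphere is an eigenvector. *)
Lemma symmetric_min_eigenvector S : (0 < m)%N -> S^T = S ->
  exists k, exists2 x, x != 0 & (forall w, form S x w = k * form 1%:M x w) /\
    (forall v, k * form 1%:M v v <= form S v v).
Proof.
move=> m0 sS.
have cform (B : 'M[R]_m) : continuous (fun v => form B v v).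
  move=> v; apply: differentiable_continuous.
  have sB := smooth_form openT (smooth_cst setT B) (@smooth_id R _ setT)
    (@smooth_id R _ setT).
  exact: smooth_differentiable sB I.
pose A := [set v : 'rV[R]_m | form 1%:M v v = 1].
have cA : compact A.
  apply: bounded_closed_compact.
    exists 1; split => // M M1 v vA; have v1 : form 1%:M v v = 1 := vA; rewrite form1E in v1.
    apply: le_trans (ltW M1); rewrite [leLHS]/Num.Def.normr /= mx_normrE.
    apply/bigmax_leP; split=> // -[i j] _ /=.
    rewrite ord1 -(@ler_pXn2r _ 2) ?nnegrE // expr1n real_normK ?num_real // -v1.
    by rewrite (bigD1 j) //= lerDl sumr_ge0 // => l _; exact: sqr_ge0.
  have -> : A = (fun v => form 1%:M v v) @^-1` [set 1] by [].
  apply: closed_comp; first by move=> v _; exact: cform.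
  exact: closed_eq.
have A0 : A !=set0.
  exists (delta_mx 0 (Ordinal m0)); rewrite /A /= form_delta !mxE eqxx //.
have [x xA xmin] := EVT_min_rV A0 cA (continuous_subspaceT (cform S)).
have {xA}x1 : form 1%:M x x = 1 by move/set_mem: xA.
have x0 : x != 0 by apply/eqP => x0; move: x1; rewrite x0 form0l => /esym/eqP; rewrite oner_eq0.
pose k := form S x x.
have kmin v : k * form 1%:M v v <= form S v v.
  have [->|v0] := eqVneq v 0; first by rewrite !form0l mulr0.
  have n0 := form1_gt0 v0; set n := form _ v v in n0 *.
  have r0 : 0 < Num.sqrt n by rewrite sqrtr_gt0.
  have := xmin ((Num.sqrt n)^-1 *: v); rewrite inE /A /= !formZl !formZr -/n -/k.
  have : n = Num.sqrt n * Num.sqrt n by rewrite -expr2 sqr_sqrtr ?ltW.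
  move: (Num.sqrt n) r0 (form S v v) => r r0 X -> h.
  have rN : r != 0 by rewrite gt_eqF.
  have : k <= r^-1 * (r^-1 * X) by apply: h; field.
  by rewrite mulrA -invfM ler_pdivlMl ?mulr_gt0 // mulrC.
exists k; exists x => //; split=> // w.
pose b := form S x w - k * form 1%:M x w.
pose d := form S w w - k * form 1%:M w w.
have d0 : 0 <= d by rewrite subr_ge0.
have sq t : 0 <= 2 * t * b + t ^+ 2 * d.
  have := kmin (x + t *: w); rewrite -subr_ge0 !formDl !formDr !formZl !formZr x1.
  rewrite (formC w x sS) (formC w x (trmx1 _ _)) -/k => h.
  suff -> : 2 * t * b + t ^+ 2 * d = k + t * form S x w + (t * form S x w + t * (t * form S w w)) -
    k * (1 + t * form 1%:M x w + (t * form 1%:M x w + t * (t * form 1%:M w w))) by [].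
  by rewrite /b /d; ring.
suff : b = 0 by move/eqP; rewrite subr_eq0 => /eqP.
clearbody b d; clear -sq d0.
have d1 : 0 < d + 1 by rewrite ltr_wpDl.
(* For d > 0 the quadratic polynomial in t is least at - b / d; replacing d by d + 1 also covers d =
   0, and the value is still negative unless b = 0. *)
have := sq (- b / (d + 1)).
have -> : 2 * (- b / (d + 1)) * b + (- b / (d + 1)) ^+ 2 * d = - (b ^+ 2 * (d + 2)) / (d + 1) ^+ 2.
  by field; rewrite gt_eqF.
rewrite pmulr_lge0 ?invr_gt0 ?exprn_gt0 // oppr_ge0 pmulr_lle0; last by rewrite ltr_wpDl.
by move=> b0; apply/eqP; rewrite -sqrf_eq0 eq_le b0 sqr_ge0.
Qed.

End MinimalEigenvalue.

#[local] Opaque form.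

(** * Riemannian metrics in coordinates *)

(** Instantiated twice, with the metric of the ambient space in a chart and with the induced metric,
    so that the Levi-Civita calculus is developed once for both. *)
Record metric_on (R : realType) n (O : set 'rV[R]_n) (G : 'rV[R]_n -> 'M[R]_n) := {
  metric_on_open : open O;
  metric_on_smooth : smooth_on O G;
  metric_on_sym : forall y, O y -> (G y)^T = G y;
  metric_on_pos : forall y, O y -> forall v, v != 0 -> 0 < form (G y) v v
}.

Section Christoffel.
Context {R : realType} {n : nat}.
Variables (O : set 'rV[R]_n) (G : 'rV[R]_n -> 'M[R]_n).
Hypothesis mG : metric_on O G.
Let oO := metric_on_open mG.
Let sG := metric_on_smooth mG.

Lemma metric_unit y : O y -> G y \in unitmx.
Proof.
move=> Oy; rewrite -row_free_unit; apply: inj_row_free => v vG.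
apply/eqP/negP => /negP v0; have := metric_on_pos mG Oy v0.
by rewrite form_mul0 // ltxx.
Qed.

Lemma metric_ge0 y v : O y -> 0 <= form (G y) v v.
Proof.
move=> Oy; have [->|v0] := eqVneq v 0; first by rewrite form0l.
by rewrite ltW // (metric_on_pos mG).
Qed.

Lemma metric_eq0 y v : O y -> form (G y) v v = 0 -> v = 0.
Proof.
move=> Oy E; apply/eqP/negP => /negP v0; have := metric_on_pos mG Oy v0.
by rewrite E ltxx.
Qed.

Let dG y : O y -> differentiable G y.
Proof. exact: smooth_differentiable. Qed.

Lemma derive_metric_sym y v : O y -> ('D_v G y)^T = 'D_v G y.
Proof.
move=> Oy; have [_ <-] := derive_trmx v (dG Oy).
by apply: derive_near_eq oO _ Oy => z /set_mem; exact: (metric_on_sym mG).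
Qed.

(** The Koszul formula for fields with constant components: lowering the index removes the inverse
    of the metric. *)
Lemma christoffel_lower y v w z : O y ->
  form (G y) (christoffel G y v w) z =
  2^-1 * (form ('D_v G y) w z + form ('D_w G y) v z - form ('D_z G y) v w).
Proof.
move=> Oy; rewrite /christoffel formZl; congr (_ * _).
refine (etrans (form_koszul _ _ _ _ _ _ (metric_unit Oy)) _).
by rewrite -(derive_dir_sum _ _ _ (dG Oy)) -row_sum_delta.
Qed.

Lemma christoffelC y v w : O y -> christoffel G y v w = christoffel G y w v.
Proof.
move=> Oy; rewrite /christoffel; congr (_ *: (_ *m _)); apply/rowP => l; rewrite !mxE.
exact: form_koszulC (derive_metric_sym _ Oy).
Qed.

Lemma christoffel_bilin y : O y -> bilin (christoffel G y).
Proof.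
move=> Oy; have lin w : linear (christoffel G y ^~ w).
  move=> a v v'; rewrite /christoffel scalerA mulrC -scalerA -scalerDr; congr (_ *: _).
  rewrite scalemxAl -mulmxDl; congr (_ *m _); apply/rowP => l; rewrite !mxE.
  rewrite (derive_dirD _ _ (dG Oy)) (derive_dirZ _ _ (dG Oy)).
  exact: form_koszul_linear.
split=> // v a w w'; rewrite !(christoffelC v) //; exact: lin.
Qed.

Lemma smooth_christoffel v w : smooth_on O (fun y => christoffel G y v w).
Proof.
apply: (smooth_mxP _ oO).2 => i j; under eq_fun do rewrite mxE.
apply: smooth_scale => //; apply: (smooth_mxP _ oO).1; apply: smooth_mulmx => //; last first.
  by apply: smooth_invmx => //; exact: metric_unit.
apply: (smooth_mxP _ oO).2 => i' j'; under eq_fun do rewrite mxE.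
have sf a b c : smooth_on O (fun y => form ('D_a G y) b c).
  apply: smooth_form => //; [exact: smooth_derive|exact: smooth_cst|exact: smooth_cst].
apply: smooth_add => //; first by apply: smooth_add.
have := smooth_scale (-1) oO (sf (delta_mx 0 j') v w).
by apply: smooth_eq => // y _; rewrite mulN1r.
Qed.

End Christoffel.

(** The connection is tensorial in its direction, which can therefore be frozen at a point; the
    calculus below is stated for constant directions [cst a]. *)
Lemma cov_at (R : realType) n (V : normedModType R) (G : 'rV[R]_n -> 'M[R]_n)
    (F : V -> 'rV[R]_n) X Z u : cov G F X Z u = cov G F (cst (X u)) Z u.
Proof. by rewrite /cov. Qed.

(** * The Levi-Civita connection along a map *)

Section Connection.
Context {R : realType} {n : nat}.
Variables (O : set 'rV[R]_n) (G : 'rV[R]_n -> 'M[R]_n).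
Hypothesis mG : metric_on O G.
Let oO := metric_on_open mG.
Let sG := metric_on_smooth mG.
Let Gam := christoffel G.

Let half_sum (a a' b d : R) : a' = a -> 2^-1 * (a + b - d) + 2^-1 * (a' + d - b) = a.
Proof. by move=> ->; field. Qed.

Lemma christoffel_compat y p z w : O y ->
  form (G y) (Gam y p z) w + form (G y) z (Gam y p w) = form ('D_p G y) z w.
Proof.
move=> Oy; rewrite (formC z _ (metric_on_sym mG Oy)).
have sD := derive_metric_sym mG p Oy.
exact: (etrans (congr2 +%R (christoffel_lower mG p z w Oy) (christoffel_lower mG p w z Oy))
  (half_sum _ _ (formC w z sD))).
Qed.

Section Along.
Context {V : normedModType R}.
Variables (U : set V) (F : V -> 'rV[R]_n).
Hypotheses (oU : open U) (UO : forall u, U u -> O (F u)) (sF : smooth_on U F).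
Implicit Types (a b u : V) (Z W : V -> 'rV[R]_n).

Lemma smooth_metric_along : smooth_on U (fun u => G (F u)).
Proof. exact: smooth_comp_mx oU oO UO sF sG. Qed.

Lemma smooth_cov a Z : smooth_on U Z -> smooth_on U (cov G F (cst a) Z).
Proof.
move=> sZ; apply: smooth_add => //; first exact: smooth_derive.
apply: (smooth_bilin_mx oU oO UO sF (smooth_derive a sF) sZ).
  by move=> y Oy; exact: christoffel_bilin mG _ Oy.
exact: smooth_christoffel.
Qed.

Lemma cov_dirP a b c Z u : U u -> smooth_on U Z ->
  cov G F (cst (c *: a + b)) Z u = c *: cov G F (cst a) Z u + cov G F (cst b) Z u.
Proof.
move=> Uu sZ; have bG := christoffel_bilin mG (UO Uu).
have dF := smooth_differentiable sF Uu; have dZ := smooth_differentiable sZ Uu.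
rewrite /cov /= (derive_dirD _ _ dF) (derive_dirZ _ _ dF).
rewrite (derive_dirD _ _ dZ) (derive_dirZ _ _ dZ) bG.1.
by rewrite scalerDr addrACA.
Qed.

Lemma cov_compat a Z W u : U u -> smooth_on U Z -> smooth_on U W ->
  'D_a (fun u => form (G (F u)) (Z u) (W u)) u =
  form (G (F u)) (cov G F (cst a) Z u) (W u) + form (G (F u)) (Z u) (cov G F (cst a) W u).
Proof.
move=> Uu sZ sW.
have dGF := smooth_differentiable smooth_metric_along Uu.
have dF := smooth_differentiable sF Uu.
have dG := smooth_differentiable sG (UO Uu).
rewrite (derive_form _ dGF (smooth_differentiable sZ Uu) (smooth_differentiable sW Uu)).
have -> : 'D_a (fun u => G (F u)) u = 'D_('D_a F u) G (F u) by exact: derive_comp dF dG.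
rewrite /cov /= formDl formDr -(christoffel_compat _ _ _ (UO Uu)) /Gam.
by move: (form _ _ _) (form _ _ _) (form _ _ _) (form _ _ _) => *; ring.
Qed.

Lemma cov_scale a (f : V -> R) Z u : U u -> smooth_on U f -> smooth_on U Z ->
  cov G F (cst a) (fun u => f u *: Z u) u =
  'D_a f u *: Z u + f u *: cov G F (cst a) Z u.
Proof.
move=> Uu sf sZ; have bG := christoffel_bilin mG (UO Uu).
have df := smooth_differentiable sf Uu; have dZ := smooth_differentiable sZ Uu.
rewrite /cov /= (bilinZr _ _ _ bG) scalerDr addrA; congr (_ + _).
apply/rowP => j; rewrite -derive_entry; last first.
  apply: differentiable_mxP => i k; under eq_fun do rewrite mxE.
  by apply: differentiable_mul => //; exact: differentiable_entry.
under eq_fun do rewrite mxE.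
by rewrite (derive_mulE _ df (differentiable_entry _ _ dZ)) !mxE -derive_entry.
Qed.

Lemma cov_add a Z W u : U u -> smooth_on U Z -> smooth_on U W ->
  cov G F (cst a) (fun u => Z u + W u) u =
  cov G F (cst a) Z u + cov G F (cst a) W u.
Proof.
move=> Uu sZ sW; have bG := christoffel_bilin mG (UO Uu).
rewrite /cov /= (bilinDr _ _ _ bG) addrACA; congr (_ + _).
by rewrite derive_addE //; [exact: smooth_differentiable sZ Uu|exact: smooth_differentiable sW Uu].
Qed.

Lemma cov_eq X Z W u : U u -> {in U, Z =1 W} -> cov G F X Z u = cov G F X W u.
Proof.
move=> Uu ZW; rewrite /cov (derive_near_eq _ oU ZW Uu) ZW //; exact: mem_set.
Qed.

(** Constant directions commute, so the absence of torsion comes down to Schwarz's theorem for F and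
    the symmetry of the Christoffel symbols. *)
Lemma cov_torsion a b u : U u ->
  cov G F (cst a) ('D_b F) u = cov G F (cst b) ('D_a F) u.
Proof.
move=> Uu; refine (congr2 +%R (derive_comm_mx a b oU Uu sF) _).
exact: (christoffelC mG ('D_a F u) ('D_b F u) (UO Uu)).
Qed.

(** The terms are arranged for antisymmetrization in a and b: the second derivatives of Z and F are
    symmetric by Schwarz, and the two terms with a first derivative of Z are exchanged. *)
Lemma cov_cov a b Z u : U u -> smooth_on U Z ->
  cov G F (cst a) (cov G F (cst b) Z) u =
  'D_a ('D_b Z) u
  + ('D_('D_a F u) (fun y => Gam y ('D_b F u) (Z u)) (F u)
     + Gam (F u) ('D_a ('D_b F) u) (Z u) + Gam (F u) ('D_b F u) ('D_a Z u))
  + (Gam (F u) ('D_a F u) ('D_b Z u)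
     + Gam (F u) ('D_a F u) (Gam (F u) ('D_b F u) (Z u))).
Proof.
move=> Uu sZ; have bG y (Oy : O y) := christoffel_bilin mG Oy.
have sDF := smooth_derive b sF; have sDZ := smooth_derive b sZ.
have sGam := smooth_christoffel mG.
rewrite [LHS]/cov /=; refine (congr2 +%R _ (bilinDr _ _ _ (bG _ (UO Uu)))).
rewrite derive_addE; first last.
- exact: smooth_differentiable (smooth_bilin_mx oU oO UO sF sDF sZ bG sGam) Uu.
- exact: smooth_differentiable sDZ Uu.
exact: (congr2 +%R erefl (derive_bilin_mx oU oO UO sF sDF sZ bG sGam a Uu)).
Qed.

End Along.

Lemma curvatureE y v w z : O y ->
  curvature G y v w z =
  'D_v (fun y => Gam y w z) y + Gam y v (Gam y w z)
  - ('D_w (fun y => Gam y v z) y + Gam y w (Gam y v z)).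
Proof.
move=> Oy; have bGy := christoffel_bilin mG Oy.
have cc a b : cov G id (cst a) (cov G id (cst b) (cst z)) y =
    'D_a (fun y => Gam y b z) y + Gam y a (Gam y b z).
  have D0 : 'D_b (cst z : 'rV[R]_n -> 'rV[R]_n) = cst 0.
    by apply/funext => u; exact: derive_cst.
  have D1 : 'D_b (@id 'rV[R]_n) = cst b by apply/funext => u; exact: derive_id.
  refine (etrans (cov_cov oO (fun u Ou => Ou) (smooth_id O) a b Oy (smooth_cst O z)) _).
  rewrite D0 D1 (derive_cst 0 y a) (derive_cst b y a) (derive_cst z y a) (derive_id y a)
    (derive_cst z y b) (derive_id y b).
  have zs (p q r s t : 'rV[R]_n) : r = 0 -> s = 0 -> t = 0 -> 0 + (p + r + s) + (t + q) = p + q.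
    by move=> -> -> ->; rewrite !addr0 !add0r.
  exact: zs (bilin0l _ bGy) (bilin0r _ bGy) (bilin0r _ bGy).
rewrite /curvature /curvature_op !cc.
have -> : cov G id (lie_bracket (cst v) (cst w)) (cst z) y = 0.
  rewrite /cov /lie_bracket !derive_cst subrr !derive0 add0r.
  exact: (bilin0l _ bGy).
by rewrite subr0.
Qed.

(** The Ricci identity for sections along F. It needs no extension of Z off the image of F, because
    both sides are compared through their expressions in Christoffel symbols. *)
Lemma cov_curvature {V : normedModType R} (U : set V) (F : V -> 'rV[R]_n) a b Z u :
  open U -> (forall u, U u -> O (F u)) -> smooth_on U F -> smooth_on U Z -> U u ->
  cov G F (cst a) (cov G F (cst b) Z) u - cov G F (cst b) (cov G F (cst a) Z) u =
  curvature G (F u) ('D_a F u) ('D_b F u) (Z u).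
Proof.
move=> oU UO sF sZ Uu; rewrite (curvatureE _ _ _ (UO _ Uu)).
refine (etrans (congr2 (fun x y => x - y) (cov_cov oU UO sF a b Uu sZ)
                                          (cov_cov oU UO sF b a Uu sZ)) _).
rewrite (derive_comm_mx a b oU Uu sF) (derive_comm_mx a b oU Uu sZ).
have cancel (x p g k h q p' q' : 'rV[R]_n) :
    x + (p + g + k) + (h + q) - (x + (p' + g + h) + (k + q')) = p + q - (p' + q').
  by apply/rowP => j; rewrite !mxE; ring.
exact: cancel.
Qed.

End Connection.

#[local] Opaque curvature christoffel cov.

(* Pair symmetry follows from the Bianchi identity; polarizing T v w w v = 0
   then makes T antisymmetric in its second and third arguments, so that the
   Bianchi identity becomes 3 T = 0. *)
Lemma sectional_determines_curvature (R : realFieldType) (V : zmodType)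
    (T : V -> V -> V -> V -> R) :
  (forall v v' w z x, T (v + v') w z x = T v w z x + T v' w z x) ->
  (forall v w z z' x, T v w (z + z') x = T v w z x + T v w z' x) ->
  (forall v w z x, T v w z x = - T w v z x) ->
  (forall v w z x, T v w z x = - T v w x z) ->
  (forall v w z x, T v w z x + T w z v x + T z v w x = 0) ->
  (forall v w, T v w w v = 0) ->
  forall v w z x, T v w z x = 0.
Proof.
move=> add1 add3 anti12 anti34 bianchi sect.
have pair v w z x : T v w z x = T z x v w.
  have := bianchi v w z x; have := bianchi w z x v.
  have := bianchi z x v w; have := bianchi x v w z.
  have := anti34 w z x v; have := anti34 z x w v; have := anti34 x v z w.
  have := anti34 v z x w; have := anti12 z v w x; have := anti34 v w x z.
  have := anti12 x w z v; have := anti34 w x z v; lra.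
have sect4 v w v' : T v w w v' = 0.
  have := sect (v + v') w; rewrite add1 (anti34 v) (anti34 v') !add3.
  have := sect v w; have := sect v' w; have := anti34 v w w v; have := anti34 v' w w v'.
  have := anti34 v' w w v; have := anti34 v w w v'.
  have := pair v' w w v; have := anti12 w v v' w; have := anti34 v w v' w; lra.
have anti23 v w z x : T v w z x = - T v z w x.
  have := sect4 v (w + z) x; rewrite add3 (anti12 v (w + z) w) (anti12 v (w + z) z) !add1.
  have := sect4 v w x; have := sect4 v z x.
  have := anti12 v w w x; have := anti12 v w z x.
  have := anti12 v z w x; have := anti12 v z z x; lra.
move=> v w z x; have := bianchi v w z x.
have := anti23 w z v x; have := anti12 w v z x; have := anti12 z v w x.
have := anti23 v z w x; lra.
Qed.

(** The right-hand side has all the symmetries of a curvature tensor, so the difference of the two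
    sides is such a tensor with vanishing sectional part. *)
Lemma constant_sectional_curvature (R : realFieldType) (V : zmodType)
    (g : V -> V -> R) (K : V -> V -> V -> V -> R) c :
  (forall v w, g v w = g w v) ->
  (forall v v' w, g (v + v') w = g v w + g v' w) ->
  (forall v v' w z x, K (v + v') w z x = K v w z x + K v' w z x) ->
  (forall v w z z' x, K v w (z + z') x = K v w z x + K v w z' x) ->
  (forall v w z x, K v w z x = - K w v z x) ->
  (forall v w z x, K v w z x = - K v w x z) ->
  (forall v w z x, K v w z x + K w z v x + K z v w x = 0) ->
  (forall v w, K v w w v = c * (g v v * g w w - g v w ^+ 2)) ->
  forall v w z x, K v w z x = c * (g w z * g v x - g v z * g w x).
Proof.
move=> sg gD Kl Kr Ka Ks Kb Kc v w z x.
have gDr a b b' : g a (b + b') = g a b + g a b' by rewrite !(sg a) gD.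
apply/eqP; rewrite -subr_eq0; apply/eqP; move: v w z x.
apply: sectional_determines_curvature => [v v' w z x|v w z z' x|v w z x|v w z x|v w z x|v w].
- rewrite Kl !gD; ring.
- rewrite Kr !gDr; ring.
- rewrite Ka; ring.
- rewrite Ks; ring.
- have := Kb v w z x; rewrite (sg z v) (sg w z) (sg w v) => /eqP.
  rewrite addr_eq0 => /eqP; move: (K z v w x) => r E.
  have -> : K w z v x = - r - K v w z x by rewrite -E; ring.
  ring.
- rewrite Kc (sg w v); ring.
Qed.

(** * Symmetries of the curvature tensor and constant curvature *)

Section Curvature.
Context {R : realType} {n : nat}.
Variables (O : set 'rV[R]_n) (G : 'rV[R]_n -> 'M[R]_n).
Hypothesis mG : metric_on O G.
Let oO := metric_on_open mG.
Let sG := metric_on_smooth mG.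
Let Gam := christoffel G.
Let K := curvature G.

Lemma curvature_anti y v w z : O y -> K y v w z = - K y w v z.
Proof.
by move=> Oy; rewrite /K (curvatureE mG v w z Oy) (curvatureE mG w v z Oy) opprB.
Qed.

Let dGam y v w : O y -> differentiable (fun y => Gam y v w) y.
Proof. exact: smooth_differentiable (smooth_christoffel mG v w). Qed.

Let derive_GamD y u v v' w : O y ->
  'D_u (fun y => Gam y (v + v') w) y =
  'D_u (fun y => Gam y v w) y + 'D_u (fun y => Gam y v' w) y.
Proof.
move=> Oy; rewrite -(derive_addE u (dGam v w Oy) (dGam v' w Oy)).
apply: derive_near_eq oO _ Oy => x /set_mem Ox.
exact: bilinDl (christoffel_bilin mG Ox).
Qed.

Let derive_GamDr y u v w w' : O y ->
  'D_u (fun y => Gam y v (w + w')) y =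
  'D_u (fun y => Gam y v w) y + 'D_u (fun y => Gam y v w') y.
Proof.
move=> Oy; rewrite -(derive_addE u (dGam v w Oy) (dGam v w' Oy)).
apply: derive_near_eq oO _ Oy => x /set_mem Ox.
exact: bilinDr (christoffel_bilin mG Ox).
Qed.

Let derive_GamC y u v w : O y ->
  'D_u (fun y => Gam y v w) y = 'D_u (fun y => Gam y w v) y.
Proof.
move=> Oy; apply: derive_near_eq oO _ Oy => x /set_mem Ox.
exact: (christoffelC mG v w Ox).
Qed.

Let sub_addACA (a a' b b' c c' d d' : 'rV[R]_n) :
  (a + a') + (b + b') - ((c + c') + (d + d')) = a + b - (c + d) + (a' + b' - (c' + d')).
Proof. by apply/rowP => j; rewrite !mxE; ring. Qed.

Let cyclic_cancel (a b c d e f : 'rV[R]_n) :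
  a + b - (c + d) + (c + d - (e + f)) + (e + f - (a + b)) = 0.
Proof. by apply/rowP => j; rewrite !mxE; ring. Qed.

Let scale_combination (a : R) (p q r s : 'rV[R]_n) :
  a *: p + a *: q - (a *: r + a *: s) = a *: (p + q - (r + s)).
Proof. by rewrite -!scalerDr -scalerBr. Qed.

Lemma curvature_addl y v v' w z : O y -> K y (v + v') w z = K y v w z + K y v' w z.
Proof.
move=> Oy; have bG := christoffel_bilin mG Oy.
rewrite /K !(curvatureE mG _ _ _ Oy) (derive_GamD w v v' z Oy).
rewrite (derive_dirD _ _ (dGam w z Oy)) !(bilinDl _ _ _ bG) (bilinDr _ _ _ bG).
exact: sub_addACA.
Qed.

Lemma curvature_addr y v w z z' : O y -> K y v w (z + z') = K y v w z + K y v w z'.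
Proof.
move=> Oy; have bG := christoffel_bilin mG Oy.
rewrite /K !(curvatureE mG _ _ _ Oy) !(bilinDr _ _ _ bG).
refine (etrans (congr2 (fun p q => p - q)
  (congr1 (+%R^~ _) (derive_GamDr v w z z' Oy))
  (congr1 (+%R^~ _) (derive_GamDr w v z z' Oy))) _).
exact: sub_addACA.
Qed.

Lemma curvature_bianchi y v w z : O y -> K y v w z + K y w z v + K y z v w = 0.
Proof.
move=> Oy; rewrite /K !(curvatureE mG _ _ _ Oy) -/Gam.
have Gs := christoffelC mG _ _ Oy.
refine (etrans (congr2 +%R (congr2 +%R (congr2 (fun p q => p - q)
  (congr2 +%R (derive_GamC v w z Oy) (congr1 (Gam y v) (Gs w z))) erefl)
  (congr2 (fun p q => p - q)
  (congr2 +%R (derive_GamC w z v Oy) (congr1 (Gam y w) (Gs z v))) erefl))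
  (congr2 (fun p q => p - q)
  (congr2 +%R (derive_GamC z v w Oy) (congr1 (Gam y z) (Gs v w))) erefl)) _).
exact: cyclic_cancel.
Qed.

(** The function |z|^2, for z extended by constant components, has symmetric second derivatives.
    Compatibility with the metric expands them; the products of two first covariant derivatives are
    symmetric and cancel, leaving the curvature term. *)
Lemma curvature_skew y v w z : O y -> form (G y) (K y v w z) z = 0.
Proof.
have fin (p p' r r' : R) : r = r' -> 2 * (p + r) = 2 * (p' + r') -> p - p' = 0.
  by move=> ->; lra.
move=> Oy; pose N a := cov G id (cst a).
have OO u : O u -> O (id u) by [].
have sz := smooth_cst O z; have si := @smooth_id R _ O.
have sN a : smooth_on O (N a (cst z)) by exact: (smooth_cov mG oO OO si a sz).
pose q u := form (G u) z z.
have sq : smooth_on O q by exact: (smooth_form oO sG sz sz).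
have E a b : 'D_a ('D_b q) y = 2 * (form (G y) (N a (N b (cst z)) y) z +
   form (G y) (N b (cst z) y) (N a (cst z) y)).
  have -> : 'D_a ('D_b q) y = 'D_a (fun u => 2 * form (G u) (N b (cst z) u) z) y.
    apply: derive_near_eq oO _ Oy => u /set_mem Ou.
    rewrite (cov_compat mG oO OO si b Ou sz sz) -/(N b) /=.
    by rewrite (formC z _ (metric_on_sym mG Ou)) mulrDl mul1r.
  rewrite derive_mulrE; last exact: smooth_differentiable (smooth_form oO sG (sN b) sz) Oy.
  by rewrite (cov_compat mG oO OO si a Oy (sN b) sz).
have := cov_curvature mG v w oO OO si sz Oy.
rewrite (derive_id y v) (derive_id y w) => Kc.
have e := etrans (esym (E v w)) (etrans (derive_comm v w oO Oy sq) (E w v)).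
rewrite -[K y v w z]Kc formBl.
exact: fin (formC (N w (cst z) y) (N v (cst z) y) (metric_on_sym mG Oy)) e.
Qed.

Lemma curvature_skew2 y v w z x : O y ->
  form (G y) (K y v w z) x = - form (G y) (K y v w x) z.
Proof.
move=> Oy; have := curvature_skew v w (z + x) Oy.
rewrite (curvature_addr _ _ _ _ Oy) formDl !formDr !(curvature_skew _ _ _ Oy).
by rewrite add0r addr0 => /eqP; rewrite addr_eq0 => /eqP.
Qed.

Lemma curvature0l y w z : O y -> K y 0 w z = 0.
Proof. by move=> Oy; apply: (addrI (K y 0 w z)); rewrite -curvature_addl // !addr0. Qed.

Lemma curvatureZl y a v w z : O y -> K y (a *: v) w z = a *: K y v w z.
Proof.
move=> Oy; have bG := christoffel_bilin mG Oy.
rewrite /K !(curvatureE mG _ _ _ Oy) (derive_dirZ _ _ (dGam w z Oy)) !(bilinZl _ _ _ bG).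
rewrite (bilinZr a w (christoffel G y v z) bG).
have -> : 'D_w (fun y => christoffel G y (a *: v) z) y =
          a *: 'D_w (fun y => christoffel G y v z) y.
  rewrite -(derive_scaleE a w (dGam v z Oy)).
  apply: derive_near_eq oO _ Oy => x /set_mem Ox.
  exact: bilinZl (christoffel_bilin mG Ox).
exact: scale_combination.
Qed.

Lemma curvaturevv y v z : O y -> K y v v z = 0.
Proof.
move=> Oy; have /eqP := curvature_anti v v z Oy.
by rewrite -addr_eq0 -mulr2n -scaler_nat scaler_eq0 pnatr_eq0 /= => /eqP.
Qed.

Section ConstantCurvature.
Variables (c : R) (y : 'rV[R]_n).
Hypothesis Oy : O y.
Hypothesis cK : forall v w, row_free (col_mx v w) -> sectional_curvature G y v w = c.

Let g := form (G y).

(** The hypothesis [cK] speaks of independent pairs only; on dependent pairs both sides vanish. On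
    independent pairs the denominator must be shown to be nonzero before it is cleared. *)
Lemma sectional_numerator (v w : 'rV[R]_n) :
  g (K y v w w) v = c * (g v v * g w w - g v w ^+ 2).
Proof.
have [->|w0] := eqVneq w 0.
  rewrite /g (curvature_anti _ _ _ Oy) curvature0l // oppr0 !form0r form0l.
  by rewrite expr2 !mulr0 subr0 mulr0.
have gw : 0 < g w w by exact: (metric_on_pos mG Oy).
have [[t ->]|nd] := pselect (exists t, v = t *: w).
  by rewrite (curvatureZl _ _ _ _ Oy) curvaturevv // scaler0 /g form0l !(formZl, formZr); ring.
have rf : row_free (col_mx v w).
  apply: inj_row_free => u; rewrite -[u]hsubmxK mul_row_col.
  set a := lsubmx u; set b := rsubmx u.
  rewrite (mx11_scalar a) (mx11_scalar b) !mul_scalar_mx => E.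
  have a0 : a 0 0 = 0.
    apply/eqP/negP => /negP a0; apply: nd; exists (- ((a 0 0)^-1 * b 0 0)).
    rewrite scaleNr -scalerA; apply/eqP; rewrite -addr_eq0 -[v in v + _]scale1r -(mulVf a0).
    by rewrite -scalerA -scalerDr E scaler0.
  move: E; rewrite a0 scale0r add0r => /eqP; rewrite scaler_eq0 (negPf w0) orbF => /eqP ->.
  by rewrite !raddf0 row_mx0.
have d0 : 0 < g v v * g w w - g v w ^+ 2.
  (* This vector is the part of v orthogonal to w; the Gram determinant is its squared length times
     that of w. *)
  have x0 : v - (g v w / g w w) *: w != 0.
    by apply/eqP => /eqP; rewrite subr_eq0 => /eqP E; apply: nd; eexists; exact: E.
  have := metric_on_pos mG Oy x0.
  rewrite formBl !formBr !formZl !formZr (formC w v (metric_on_sym mG Oy)) => x1.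
  have -> : g v v * g w w - g v w ^+ 2 = (g v v - g v w / g w w * g v w -
      (g v w / g w w * g v w - g v w / g w w * (g v w / g w w * g w w))) * g w w.
    by field; rewrite gt_eqF.
  by rewrite pmulr_lgt0 // /g; apply: le_lt_trans x1; rewrite lexx.
by rewrite -(cK rf) /sectional_curvature divfK // gt_eqF.
Qed.

Lemma constant_curvature (v w z x : 'rV[R]_n) :
  g (K y v w z) x = c * (g w z * g v x - g v z * g w x).
Proof.
move: v w z x; apply: (@constant_sectional_curvature _ _ g (fun v w z x => g (K y v w z) x)).
- by move=> a b; rewrite /g (formC _ _ (metric_on_sym mG Oy)).
- by move=> a b e; exact: formDl.
- move=> v v' w z x; exact: etrans (congr1 (g ^~ x) (curvature_addl v v' w z Oy)) (formDl _ _ _ _).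
- move=> v w z z' x; exact: etrans (congr1 (g ^~ x) (curvature_addr v w z z' Oy)) (formDl _ _ _ _).
- move=> v w z x; exact: etrans (congr1 (g ^~ x) (curvature_anti v w z Oy)) (formNl _ _ _).
- move=> v w z x; exact: (curvature_skew2 v w z x Oy).
- move=> v w z x; have := congr1 (g ^~ x) (curvature_bianchi v w z Oy).
  by rewrite /g (formDl _ (_ + _)) (formDl _ (K y v w z)) form0l.
- exact: sectional_numerator.
Qed.

End ConstantCurvature.
End Curvature.

(** * Submanifolds and hypersurfaces *)

Section AlongField.
Context {R : realType} {m n : nat}.
Variables (U : set 'rV[R]_m) (P : 'rV[R]_m -> 'rV[R]_m -> 'rV[R]_n).
Hypothesis oU : open U.
Hypothesis lP : forall u, U u -> linear (P ^~ u).
Hypothesis sP : forall c, smooth_on U (P c).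

Let P_sum u c : U u -> P c u = c *m \matrix_i P (delta_mx 0 i) u.
Proof.
move=> Uu; have l0 : P 0 u = 0.
  by have := lP Uu (-1) 0 0; rewrite scaler0 addr0 scaleN1r addNr.
have lZ a v : P (a *: v) u = a *: P v u.
  by have := lP Uu a v 0; rewrite l0 !addr0.
have lD v w : P (v + w) u = P v u + P w u.
  by have := lP Uu 1 v w; rewrite !scale1r.
rewrite mulmx_sum_row {1}(row_sum_delta c).
elim/big_rec2 : _ => [//|i y z _ IH].
by rewrite lD lZ IH rowK.
Qed.

Let J u := \matrix_i P (delta_mx 0 i) u.

Let sJ : smooth_on U J.
Proof.
apply/(smooth_mxP _ oU) => i j; have := (smooth_mxP _ oU).1 (sP (delta_mx 0 i)) 0 j.
by apply: smooth_eq => // u _; rewrite mxE.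
Qed.

Lemma smooth_along_field E : smooth_on U E -> smooth_on U (fun u => P (E u) u).
Proof.
move=> sE; apply: (smooth_eq oU _ (smooth_mulmx oU sE sJ)) => u /set_mem Uu.
by rewrite -P_sum.
Qed.

(** Separates the derivative of the direction field E from the derivative with the direction frozen.
    It is used with P v equal to the derivative of F, or to the covariant derivative of a section,
    in the direction v. *)
Lemma derive_along_field E a u : U u -> smooth_on U E ->
  'D_a (fun u => P (E u) u) u = P ('D_a E u) u + 'D_a (P (E u)) u.
Proof.
move=> Uu sE.
have dE := smooth_differentiable sE Uu; have dJ := smooth_differentiable sJ Uu.
have -> : 'D_a (fun u => P (E u) u) u = 'D_a (fun u => E u *m J u) u.
  by apply: derive_near_eq oU _ Uu => x /set_mem Ux; exact: P_sum.
have [_ ->] := derive_mulmx a dE dJ; rewrite -P_sum //; congr (_ + _).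
have -> : 'D_a (P (E u)) u = 'D_a (fun x => E u *m J x) u.
  by apply: derive_near_eq oU _ Uu => x /set_mem Ux; exact: P_sum.
have [_ ->] := derive_mulmx a (differentiable_cst (E u) u) dJ.
by rewrite derive_cst mul0mx add0r.
Qed.

End AlongField.

(** * The second fundamental form of an immersion *)

Section Submanifold.
Context {R : realType} {m n : nat}.
Variables (O : set 'rV[R]_n) (G : 'rV[R]_n -> 'M[R]_n).
Hypothesis mG : metric_on O G.
Variables (U : set 'rV[R]_m) (F : 'rV[R]_m -> 'rV[R]_n).
Hypotheses (oU : open U) (UO : forall u, U u -> O (F u)) (sF : smooth_on U F).
Hypothesis iF : forall u, U u -> forall v, 'D_v F u = 0 -> v = 0.
Implicit Types (a b v w z u : 'rV[R]_m).

Let g := induced_metric G F.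
Let T a := cov G F (cst a).
Let C := christoffel g.
Notation "<[ Z , W ]>_ u" := (form (G (F u)) Z W) (at level 0, u at level 2).

Let scale_sub_combination (c : R) (p q r s : 'rV[R]_n) :
  c *: p + q - (c *: r + s) = c *: (p - r) + (q - s).
Proof. by rewrite opprD addrACA -scalerBr. Qed.

Let add_zeros (x y z : R) : y = 0 -> z = 0 -> x = x + y + z.
Proof. by move=> -> ->; rewrite !addr0. Qed.

Let koszul_cancel (x y z a b c a' b' c' : R) : x = a + b -> y = a' + c -> z = b' + c' ->
  a' = a -> b' = b -> c' = c -> a - 2^-1 * (x + y - z) = 0.
Proof. by move=> -> -> -> -> -> ->; field. Qed.

Lemma linear_derive u : U u -> linear (fun v => 'D_v F u).
Proof.
move=> Uu a v w; have dF := smooth_differentiable sF Uu.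
by rewrite (derive_dirD _ _ dF) (derive_dirZ _ _ dF).
Qed.

Lemma induced_metricE u v w : U u ->
  form (g u) v w = <['D_v F u, 'D_w F u]>_u.
Proof.
move=> Uu; have lF := linear_derive Uu.
have bF : bilin ((fun v w => <['D_v F u, 'D_w F u]>_u) : _ -> _ -> R^o).
  split=> [z|z] a x y; rewrite /= (lF a x y).
    by rewrite formDl formZl.
  by rewrite formDr formZr.
rewrite [RHS](bilin_delta _ _ bF) [LHS](bilin_delta _ _ (form_bilin _)).
apply: eq_bigr => i _; apply: eq_bigr => j _; congr (_ *: _).
by rewrite form_delta /g mxE.
Qed.

Lemma induced_metric_on : metric_on U g.
Proof.
split=> //.
- apply/(smooth_mxP _ oU) => i j.
  have := smooth_form oU (smooth_metric_along mG oU UO sF)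
    (smooth_derive (delta_mx 0 i) sF) (smooth_derive (delta_mx 0 j) sF).
  by apply: smooth_eq => // u _; rewrite /g mxE.
- move=> u Uu; apply/matrixP => i j; rewrite /g !mxE.
  exact: (formC _ _ (metric_on_sym mG (UO Uu))).
- move=> u Uu v v0; rewrite (induced_metricE _ _ Uu).
  apply: (metric_on_pos mG (UO Uu)); apply: contra v0 => /eqP v0.
  by apply/eqP; exact: (iF Uu).
Qed.

Lemma derive_induced_metric u a v w : U u ->
  form ('D_a g u) v w = <[T a ('D_v F) u, 'D_w F u]>_u + <['D_v F u, T a ('D_w F) u]>_u.
Proof.
move=> Uu; have mg := induced_metric_on.
rewrite -(cov_compat mG oU UO sF a Uu (smooth_derive v sF) (smooth_derive w sF)).
have dg := smooth_differentiable (metric_on_smooth mg) Uu.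
have := derive_form a dg (differentiable_cst v u) (differentiable_cst w u).
rewrite (derive_cst v u a) (derive_cst w u a) => /esym D.
refine (etrans (add_zeros _ (form0l _ _) (form0r _ _)) (etrans D _)).
by apply: derive_near_eq oU _ Uu => x /set_mem Ux; exact: induced_metricE.
Qed.

(* The second fundamental form on vectors, as opposed to vector fields. *)
Definition second_form_at u a b := second_form G F (cst a) (cst b) u.
Let h := second_form_at.

Lemma second_form_atE u a b : U u -> h u a b = T a ('D_b F) u - 'D_(C u a b) F u.
Proof.
move=> Uu; rewrite /h /second_form_at /second_form /push /nabla.
congr (_ - derive _ _ _).
transitivity ('D_a (cst b) u + christoffel g u ('D_a id u) b); first by [].
by rewrite (derive_cst b u a) add0r (derive_id u a).
Qed.

(** Tensoriality: the derivative of Y enters both the ambient and the induced covariant derivative,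
    through its image under the differential of F, and cancels in their difference. *)
Lemma second_form_fieldE X Y u : U u -> smooth_on U Y ->
  second_form G F X Y u = h u (X u) (Y u).
Proof.
move=> Uu sY; refine (etrans _ (esym (second_form_atE _ _ Uu))).
have DYF : 'D_(X u) (push F Y) u = 'D_('D_(X u) Y u) F u + 'D_(X u) ('D_(Y u) F) u.
  apply: (derive_along_field oU (P := fun v => 'D_v F)) => //.
    by move=> x Ux; exact: linear_derive.
  by move=> c; exact: smooth_derive.
have nab : nabla G F X Y u = 'D_(X u) Y u + C u (X u) (Y u).
  transitivity ('D_(X u) Y u + christoffel g u ('D_(X u) id u) (Y u)); first by [].
  by rewrite (derive_id u (X u)).
have lF v w : 'D_(v + w) F u = 'D_v F u + 'D_w F u.
  by have := linear_derive Uu 1 v w; rewrite !scale1r.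
transitivity ('D_(X u) (push F Y) u + christoffel G (F u) ('D_(X u) F u) ('D_(Y u) F u)
   - 'D_(nabla G F X Y u) F u); first by [].
rewrite DYF nab lF.
have cancel (p q r s : 'rV[R]_n) : p + q + r - (p + s) = q + r - s.
  by apply/rowP => j; rewrite !mxE; ring.
exact: cancel.
Qed.

Lemma second_form_atC u a b : U u -> h u a b = h u b a.
Proof.
move=> Uu; refine (etrans (second_form_atE _ _ Uu) (etrans _ (esym (second_form_atE _ _ Uu)))).
refine (congr2 (fun p q => p - q) (cov_torsion mG oU UO sF a b Uu) _).
exact: (congr1 (derive F u) (christoffelC induced_metric_on a b Uu)).
Qed.

Lemma second_form_at_bilin u : U u -> bilin (h u).
Proof.
move=> Uu; have lin b : linear (h u ^~ b).
  move=> c a a'; refine (etrans (second_form_atE _ _ Uu) _).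
  refine (etrans _ (esym (congr2 (fun p q => c *: p + q)
    (second_form_atE a b Uu) (second_form_atE a' b Uu)))).
  have := (christoffel_bilin induced_metric_on Uu).1 b c a a' => /= Cl.
  refine (etrans (congr2 (fun p q => p - q)
    (cov_dirP mG UO sF a a' c Uu (smooth_derive b sF))
    (etrans (congr1 (derive F u) Cl) (linear_derive Uu _ _ _))) _).
  exact: scale_sub_combination.
split=> [//|a c b b'].
exact: (etrans (second_form_atC a _ Uu) (etrans (lin a c b b')
  (congr2 (fun p q => c *: p + q) (second_form_atC b a Uu) (second_form_atC b' a Uu)))).
Qed.

Lemma smooth_second_form_at a b : smooth_on U (fun u => h u a b).
Proof.
have s1 : smooth_on U (T a ('D_b F)) := smooth_cov mG oU UO sF a (smooth_derive b sF).
have s2 : smooth_on U (fun u => 'D_(C u a b) F u).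
  apply: (smooth_along_field oU (P := fun v => 'D_v F)).
  - by move=> x Ux; exact: linear_derive.
  - by move=> c; exact: smooth_derive.
  - exact: smooth_christoffel induced_metric_on _ _.
apply: (smooth_eq oU _ (smooth_sub oU s1 s2)) => u /set_mem Uu.
by rewrite [RHS](second_form_atE _ _ Uu).
Qed.

(** The tangential part of the ambient connection is the Levi-Civita connection of the induced
    metric. In the Koszul formula for the latter, derivatives of the metric are expanded by ambient
    compatibility, and the absence of torsion leaves a single term. *)
Lemma second_form_normal u a b z : U u -> <[h u a b, 'D_z F u]>_u = 0.
Proof.
move=> Uu; refine (etrans (congr1 (fun p => form _ p _) (second_form_atE a b Uu)) _).
have tor p q : T p ('D_q F) u = T q ('D_p F) u := cov_torsion mG oU UO sF p q Uu.
refine (etrans (formBl _ _ _ _) (etrans (congr1 (fun p => _ - p)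
  (etrans (esym (induced_metricE _ _ Uu)) (christoffel_lower induced_metric_on _ _ _ Uu))) _)).
refine (koszul_cancel (derive_induced_metric a b z Uu) (derive_induced_metric b a z Uu)
  (derive_induced_metric z a b Uu) _ _ _).
- exact: (congr1 (fun p => <[p, _]>_u) (tor b a)).
- refine (etrans (congr1 (fun p => <[p, _]>_u) (tor z a)) _).
  exact: (formC _ _ (metric_on_sym mG (UO Uu))).
- exact: (congr1 (fun p => <[_, p]>_u) (tor z b)).
Qed.

End Submanifold.

(** * Gauss, Weingarten and Codazzi equations of a hypersurface *)

Section Hypersurface.
Context {R : realType} {m : nat}.
Variables (O : set 'rV[R]_m.+1) (G : 'rV[R]_m.+1 -> 'M[R]_m.+1).
Hypothesis mG : metric_on O G.
Variables (U : set 'rV[R]_m) (F nu : 'rV[R]_m -> 'rV[R]_m.+1).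
Hypotheses (oU : open U) (UO : forall u, U u -> O (F u)) (sF : smooth_on U F).
Hypothesis iF : forall u, U u -> forall v, 'D_v F u = 0 -> v = 0.
Hypothesis snu : smooth_on U nu.
Hypothesis nu_unit : forall u, U u -> form (G (F u)) (nu u) (nu u) = 1.
Hypothesis nu_normal : forall u, U u -> forall v, form (G (F u)) (nu u) ('D_v F u) = 0.
Implicit Types (a b v w z u : 'rV[R]_m).

Let g := induced_metric G F.
Let T a := cov G F (cst a).
Let C := christoffel g.
Let h := second_form_at G F.
Notation "<[ Z , W ]>_ u" := (form (G (F u)) Z W) (at level 0, u at level 2).
Let B u a b := <[h u a b, nu u]>_u.

Let compat_algebra (x y p q : R) : x + y = - p -> y = - q -> x = q - p.
Proof. by move=> E E'; rewrite -[x](addrK y) E E' opprK addrC. Qed.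

Let codazzi_algebra (p q p' q' c x y r s : R) : q - p - (q' - p') = c * (x * r - y * s) ->
  x = 0 -> y = 0 -> p - q = p' - q'.
Proof. by move=> E x0 y0; move: E; rewrite x0 y0 !mul0r subrr mulr0; lra. Qed.

Let tangential_algebra (dd d f x y b e : R) : x = - b -> y = e ->
  dd * 0 + d * x + (d * x + f * y) = - (2 * d * b) + f * e.
Proof. by move=> -> ->; ring. Qed.

Let normal_algebra (dd d f x y e : R) : x = 0 -> y = - e ->
  dd * 1 + d * x + (d * x + f * y) = dd - f * e.
Proof. by move=> -> ->; ring. Qed.

Let sym u Z W : U u -> <[Z, W]>_u = <[W, Z]>_u.
Proof. by move=> Uu; exact: (formC _ _ (metric_on_sym mG (UO Uu))). Qed.

Let sT a : smooth_on U (T a nu).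
Proof. exact: (smooth_cov mG oU UO sF a snu). Qed.

Lemma scalar_second_form_bilin u : U u -> bilin (B u : _ -> _ -> R^o).
Proof.
move=> Uu; have [l1 l2] := second_form_at_bilin mG oU UO sF iF Uu.
split=> [w|v] a x y; rewrite /B.
  by rewrite [h u _ w](l1 w a x y) formDl formZl.
by rewrite [h u v _](l2 v a x y) formDl formZl.
Qed.

Lemma scalar_second_formC u a b : U u -> B u a b = B u b a.
Proof.
move=> Uu.
exact: (congr1 (fun p => <[p, _]>_u) (second_form_atC mG oU UO sF iF a b Uu)).
Qed.

Lemma smooth_scalar_second_form a b : smooth_on U (fun u => B u a b).
Proof.
apply: (smooth_form oU (smooth_metric_along mG oU UO sF) _ snu).
exact: (smooth_second_form_at mG oU UO sF iF a b).
Qed.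

Lemma normal_part u X : U u -> (forall v, <[X, 'D_v F u]>_u = 0) ->
  X = <[X, nu u]>_u *: nu u.
Proof.
move=> Uu X0; have dF := smooth_differentiable sF Uu.
apply: (@normal_direction _ _ _ (jacobian F u)).
- exact: (metric_on_pos mG (UO Uu)).
- by move=> v; rewrite -(deriveEjacobian v dF); exact: iF.
- exact: nu_unit.
- by move=> v; rewrite -(deriveEjacobian v dF); exact: nu_normal.
- by move=> v; rewrite -(deriveEjacobian v dF) (sym _ _ Uu); exact: nu_normal.
- by move=> v; rewrite -(deriveEjacobian v dF); exact: X0.
Qed.

Lemma second_form_atE_normal u a b : U u -> h u a b = B u a b *: nu u.
Proof.
move=> Uu; apply: normal_part => // z.
exact: (second_form_normal mG oU UO sF iF a b z Uu).
Qed.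

Lemma gauss_formula u a b : U u ->
  T a ('D_b F) u = 'D_(C u a b) F u + B u a b *: nu u.
Proof.
move=> Uu; rewrite -second_form_atE_normal //.
refine (etrans _ (congr1 (+%R _) (esym (second_form_atE G F a b Uu)))).
by rewrite addrC subrK.
Qed.

Lemma weingarten_normal u a : U u -> <[T a nu u, nu u]>_u = 0.
Proof.
move=> Uu; have := cov_compat mG oU UO sF a Uu snu snu.
have -> : 'D_a (fun u => <[nu u, nu u]>_u) u = 0.
  rewrite -[RHS](derive_cst (1 : R) u a); apply: derive_near_eq oU _ Uu => x /set_mem Ux.
  exact: nu_unit.
rewrite (sym (nu u) _ Uu) => /esym/eqP.
by rewrite -mulr2n mulrn_eq0 /= => /eqP.
Qed.

Lemma weingarten u a b : U u -> <[T a nu u, 'D_b F u]>_u = - B u a b.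
Proof.
move=> Uu; have := cov_compat mG oU UO sF a Uu snu (smooth_derive b sF).
have -> : 'D_a (fun u => <[nu u, 'D_b F u]>_u) u = 0.
  rewrite -[RHS](derive_cst (0 : R) u a); apply: derive_near_eq oU _ Uu => x /set_mem Ux.
  exact: nu_normal.
move=> /esym/eqP; rewrite addr_eq0 => /eqP ->; congr (- _).
refine (etrans (congr1 (fun p => <[_, p]>_u) (gauss_formula a b Uu)) _).
by rewrite formDr formZr nu_normal // nu_unit // add0r mulr1.
Qed.

Lemma weingarten_along u a b z : U u ->
  <[T b nu u, T a ('D_z F) u]>_u = - B u b (C u a z).
Proof.
move=> Uu; refine (etrans (congr1 (fun p => <[_, p]>_u) (gauss_formula a z Uu)) _).
rewrite formDr formZr; refine (etrans (congr2 (fun p q => p + _ * q)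
  (weingarten b (C u a z) Uu) (weingarten_normal b Uu)) _).
by rewrite mulr0 addr0.
Qed.

(* Differentiates the Weingarten equation. *)
Lemma cov_cov_normal_tangential u a b z : U u ->
  <[T a (T b nu) u, 'D_z F u]>_u = B u b (C u a z) - 'D_a (fun u => B u b z) u.
Proof.
move=> Uu; have := cov_compat mG oU UO sF a Uu (sT b) (smooth_derive z sF).
have -> : 'D_a (fun u => <[T b nu u, 'D_z F u]>_u) u = - 'D_a (fun u => B u b z) u.
  have dB := smooth_differentiable (smooth_scalar_second_form b z) Uu.
  rewrite -(derive_oppE a dB); apply: derive_near_eq oU _ Uu => x /set_mem Ux.
  exact: weingarten.
move=> /esym E; refine (compat_algebra E (weingarten_along _ _ _ Uu)).
Qed.

Lemma cov_cov_normal_normal u a b : U u ->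
  <[T a (T b nu) u, nu u]>_u = - <[T b nu u, T a nu u]>_u.
Proof.
move=> Uu; have := cov_compat mG oU UO sF a Uu (sT b) snu.
have -> : 'D_a (fun u => <[T b nu u, nu u]>_u) u = 0.
  rewrite -[RHS](derive_cst (0 : R) u a); apply: derive_near_eq oU _ Uu => x /set_mem Ux.
  exact: weingarten_normal.
by move=> /esym/eqP; rewrite addr_eq0 => /eqP.
Qed.

Section ConstantCurvature.
Variable c : R.
Hypothesis cK : forall y, O y -> forall v w : 'rV[R]_m.+1, row_free (col_mx v w) ->
  sectional_curvature G y v w = c.

(** The Ricci identity for nu, paired with a tangent vector. In constant curvature, both terms of
    the curvature side contain a product of nu with a tangent vector and vanish. *)
Lemma codazzi u a b z : U u ->
  'D_a (fun u => B u z b) u - B u z (C u a b) = 'D_z (fun u => B u a b) u - B u a (C u z b).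
Proof.
move=> Uu.
have cc := constant_curvature mG (UO Uu) (cK (UO Uu)) ('D_a F u) ('D_z F u) (nu u) ('D_b F u).
have c1 := cov_curvature mG a z oU UO sF snu Uu.
have e1 := congr1 (fun p => <[p, 'D_b F u]>_u) c1.
have e2 := etrans (esym (formBl _ _ _ _)) (etrans e1 cc).
have e3 := congr2 (fun p q => p - q) (cov_cov_normal_tangential a z b Uu)
  (cov_cov_normal_tangential z a b Uu).
refine (codazzi_algebra (etrans (esym e3) e2) _ _).
- by rewrite (sym _ _ Uu); exact: nu_normal.
- by rewrite (sym _ _ Uu); exact: nu_normal.
Qed.

End ConstantCurvature.

Section NormalField.
Variable f : 'rV[R]_m -> R.
Hypothesis sf : smooth_on U f.
Let V u := f u *: nu u.

Lemma cov_normal_field u a : U u ->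
  T a V u = 'D_a f u *: nu u + f u *: T a nu u.
Proof. by move=> Uu; exact: (cov_scale mG UO a Uu sf snu). Qed.

Lemma cov_cov_normal_field u a b : U u ->
  T a (T b V) u = 'D_a ('D_b f) u *: nu u + 'D_b f u *: T a nu u
    + ('D_a f u *: T b nu u + f u *: T a (T b nu) u).
Proof.
move=> Uu; have sbf := smooth_derive b sf.
have E : {in U, T b V =1 fun u => 'D_b f u *: nu u + f u *: T b nu u}.
  by move=> x /set_mem Ux; exact: cov_normal_field.
refine (etrans (cov_eq G F oU (cst a) Uu E) _).
refine (etrans (cov_add mG UO a Uu (smooth_scaled_field oU sbf snu)
  (smooth_scaled_field oU sf (sT b))) _).
exact: (congr2 +%R (cov_scale mG UO a Uu sbf snu) (cov_scale mG UO a Uu sf (sT b))).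
Qed.

Lemma cov_normal_field_tangential u a z : U u ->
  <[T a V u, 'D_z F u]>_u = - (f u * B u a z).
Proof.
move=> Uu; refine (etrans (congr1 (fun p => <[p, _]>_u) (cov_normal_field a Uu)) _).
rewrite formDl !formZl nu_normal //.
refine (etrans (congr1 (fun p => _ + _ * p) (weingarten a z Uu)) _).
by rewrite mulr0 add0r mulrN.
Qed.

Lemma cov_normal_field_normal u a : U u -> <[T a V u, nu u]>_u = 'D_a f u.
Proof.
move=> Uu; refine (etrans (congr1 (fun p => <[p, _]>_u) (cov_normal_field a Uu)) _).
rewrite formDl !formZl nu_unit //.
refine (etrans (congr1 (fun p => _ + _ * p) (weingarten_normal a Uu)) _).
by rewrite mulr0 addr0 mulr1.
Qed.

Lemma cov_cov_normal_field_tangential u a z : U u ->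
  <[T a (T a V) u, 'D_z F u]>_u =
  - (2 * 'D_a f u * B u a z) + f u * (B u a (C u a z) - 'D_a (fun u => B u a z) u).
Proof.
move=> Uu; refine (etrans (congr1 (fun p => <[p, _]>_u) (cov_cov_normal_field a a Uu)) _).
rewrite formDl !(formDl _ (_ *: _)) !formZl nu_normal //.
exact: (tangential_algebra _ _ _ (weingarten a z Uu) (cov_cov_normal_tangential a a z Uu)).
Qed.

Lemma cov_cov_normal_field_normal u a : U u ->
  <[T a (T a V) u, nu u]>_u = 'D_a ('D_a f) u - f u * <[T a nu u, T a nu u]>_u.
Proof.
move=> Uu; refine (etrans (congr1 (fun p => <[p, _]>_u) (cov_cov_normal_field a a Uu)) _).
rewrite formDl !(formDl _ (_ *: _)) !formZl nu_unit //.
exact: (normal_algebra _ _ _ (weingarten_normal a Uu) (cov_cov_normal_normal a a Uu)).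
Qed.

End NormalField.

End Hypersurface.

(** * Tangential and normal parts of the biharmonic equation *)

Section Biharmonic.
Context {R : realType} {m : nat}.
Variables (O : set 'rV[R]_m.+1) (G : 'rV[R]_m.+1 -> 'M[R]_m.+1).
Hypothesis mG : metric_on O G.
Variables (U : set 'rV[R]_m) (F nu : 'rV[R]_m -> 'rV[R]_m.+1).
Hypotheses (oU : open U) (UO : forall u, U u -> O (F u)) (sF : smooth_on U F).
Hypothesis iF : forall u, U u -> forall v, 'D_v F u = 0 -> v = 0.
Hypothesis snu : smooth_on U nu.
Hypothesis nu_unit : forall u, U u -> form (G (F u)) (nu u) (nu u) = 1.
Hypothesis nu_normal : forall u, U u -> forall v, form (G (F u)) (nu u) ('D_v F u) = 0.
Implicit Types (a b v w z u : 'rV[R]_m).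

Let g := induced_metric G F.
Let T a := cov G F (cst a).
Let C := christoffel g.
Let h := second_form_at G F.
Notation "<[ Z , W ]>_ u" := (form (G (F u)) Z W) (at level 0, u at level 2).
Let B u a b := <[h u a b, nu u]>_u.

Variable E : 'I_m -> 'rV[R]_m -> 'rV[R]_m.
Hypothesis sE : forall i, smooth_on U (E i).
Hypothesis oE : forall u, U u -> orthonormal_at G F u (fun i => E i u).

Let add_eq_double (x y y' : R) : y = y' -> x + y + y' = x + 2 * y'.
Proof. by move=> ->; ring. Qed.

Let trace_cancel (p q r : 'I_m -> R) : \sum_i (q i + r i) = 0 ->
  \sum_i (p i + 2 * q i) = \sum_i (p i - 2 * r i).
Proof.
move=> qr; apply/eqP; rewrite -subr_eq0 -sumrB.
rewrite (_ : \sum_i _ = \sum_i 2 * (q i + r i)); first by rewrite -mulr_sumr qr mulr0.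
by apply: eq_bigr => i _; ring.
Qed.

Let tangential_term (d b f b' db x y q s r : R) :
  x - y = q - s -> db = x -> b' = y -> r = s ->
  - (2 * d * b) + f * (r - db) - - (f * b') = - (2 * (d * b)) - f * (q - 2 * s).
Proof.
move=> xy -> -> ->; have -> : x = q - s + y by rewrite -xy subrK.
ring.
Qed.

Let tangential_sum (f df : R) (p q : 'I_m -> R) :
  m%:R * df = \sum_i q i -> \sum_i (- (2 * p i) - f * q i) = 0 ->
  m%:R * f * df + 2 * \sum_i p i = 0.
Proof.
move=> pq; have -> : \sum_i (- (2 * p i) - f * q i) = - (f * (\sum_i q i) + 2 * \sum_i p i).
  rewrite !mulr_sumr -big_split -sumrN; apply: eq_bigr => i _ /=; ring.
by rewrite -pq => /eqP; rewrite oppr_eq0 mulrA [f * _]mulrC => /eqP.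
Qed.

Let solve_eigenvalue (k x y : R) : k * x + 2 * y = 0 -> y = - (k / 2) * x.
Proof.
move=> kxy; have -> : y = (k * x + 2 * y) / 2 - k / 2 * x by field.
by rewrite kxy; ring. Qed.

Let eq0_of_sum_le0 (q : 'I_m -> R) (k c : R) : (forall i, 0 <= q i) -> 0 < k -> c <= 0 ->
  \sum_i - (k * q i) = \sum_(i < m) - (c * k) -> forall i, q i = 0.
Proof.
move=> q0 k0 c0 sq i; apply/eqP; rewrite -(inj_eq (mulfI (lt0r_neq0 k0))) mulr0.
have kq j : 0 <= k * q j by rewrite mulr_ge0 // ltW.
have : \sum_j k * q j <= 0.
  rewrite -oppr_ge0 -sumrN sq sumr_ge0 // => j _.
  by rewrite oppr_ge0 mulr_le0_ge0 // ltW.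
rewrite (bigD1 i) //= => s0; rewrite eq_le kq andbT.
by apply: le_trans s0; rewrite lerDl sumr_ge0.
Qed.

Let mg := induced_metric_on mG oU UO sF iF.

Let bB u : U u -> bilin (B u : _ -> _ -> R^o).
Proof. exact: (scalar_second_form_bilin mG nu oU UO sF iF). Qed.

Let sB a b : smooth_on U (fun u => B u a b).
Proof. exact: (smooth_scalar_second_form mG oU UO sF iF snu a b). Qed.

Let symB u a b : U u -> B u a b = B u b a.
Proof. exact: (scalar_second_formC mG nu oU UO sF iF a b). Qed.

Definition scalar_mean_curvature u :=
  m%:R^-1 * \sum_(i < m) <[second_form_at G F u (E i u) (E i u), nu u]>_u.
Let f := scalar_mean_curvature.

Let UU u : U u -> U (id u).
Proof. by []. Qed.

Let sBE i : smooth_on U (fun u => B u (E i u) (E i u)).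
Proof.
exact: (smooth_bilin (T := B) oU UU (smooth_id U) (sE i) (sE i) bB sB).
Qed.

Lemma smooth_scalar_mean_curvature : smooth_on U f.
Proof.
by refine (smooth_scale _ oU (smooth_sum _ oU _)) => i _; exact: sBE.
Qed.

Let V u := f u *: nu u.

Lemma mean_curvatureE u : U u -> mean_curvature G F E u = V u.
Proof.
move=> Uu; rewrite /V /f /scalar_mean_curvature -scalerA scaler_suml.
congr (_ *: _); apply: eq_bigr => i _.
refine (etrans (second_form_fieldE G oU sF (E i) Uu (sE i)) _).
exact: (second_form_atE_normal mG oU UO sF iF nu_unit nu_normal _ _ Uu).
Qed.

Lemma smooth_cov_dir Z : smooth_on U Z -> forall a, smooth_on U (T a Z).
Proof. by move=> sZ a; exact: (smooth_cov mG oU UO sF a sZ). Qed.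

(** The derivative of the frame that arises from differentiating [T (E i x) Z x] cancels the one
    contained in [nabla]; afterwards only the value of the frame at u matters. *)
Lemma rough_laplacianE Z u : U u -> smooth_on U Z ->
  rough_laplacian G F E Z u =
  \sum_(i < m) (T (E i u) (T (E i u) Z) u - T (C u (E i u) (E i u)) Z u).
Proof.
move=> Uu sZ; apply: eq_bigr => i _; set e := E i u.
have DT : 'D_e (fun x => T (E i x) Z x) u = T ('D_e (E i) u) Z u + 'D_e (T e Z) u.
  apply: (derive_along_field oU (P := fun v => T v Z)) => //.
    by move=> x Ux c v w; exact: (cov_dirP mG UO sF v w c Ux sZ).
  exact: smooth_cov_dir.
have nab : nabla G F (E i) (E i) u = 'D_e (E i) u + C u e e.
  transitivity ('D_e (E i) u + christoffel g u ('D_e id u) e); first by [].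
  by rewrite (derive_id u e).
have Tlin : T ('D_e (E i) u + C u e e) Z u = T ('D_e (E i) u) Z u + T (C u e e) Z u.
  have := cov_dirP mG UO sF ('D_e (E i) u) (C u e e) 1 Uu sZ.
  by rewrite !scale1r.
have e1 : cov G F (E i) (cov G F (E i) Z) u =
   'D_e (fun x => T (E i x) Z x) u + christoffel G (F u) ('D_e F u) (T e Z u) by [].
have e2 : cov G F (nabla G F (E i) (E i)) Z u = T (nabla G F (E i) (E i) u) Z u.
  exact: cov_at.
refine (etrans (congr2 (fun p q => p - q) (etrans e1 (congr1 (+%R^~ _) DT))
  (etrans e2 (etrans (congr1 (fun v => T v Z u) nab) Tlin))) _).
have cancel (p q r s : 'rV[R]_m.+1) : p + q + r - (p + s) = q + r - s.
  by apply/rowP => j; rewrite !mxE; ring.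
exact: cancel.
Qed.

Lemma rough_laplacian_mean_curvature u : U u ->
  rough_laplacian G F E (mean_curvature G F E) u = rough_laplacian G F E V u.
Proof.
move=> Uu; apply: eq_bigr => i _.
have HV : {in U, mean_curvature G F E =1 V}.
  by move=> x /set_mem Ux; exact: mean_curvatureE.
refine (congr2 (fun p q => p - q) (cov_eq G F oU (E i) Uu _)
  (cov_eq G F oU (nabla G F (E i) (E i)) Uu HV)).
by move=> x /set_mem Ux; exact: (cov_eq G F oU (E i) Ux HV).
Qed.

(* The connection matrix of an orthonormal frame is antisymmetric. *)
Lemma frame_connection_trace u z : U u ->
  \sum_i B u (E i u) ('D_z (E i) u + C u z (E i u)) = 0.
Proof.
move=> Uu; pose N i := 'D_z (E i) u + C u z (E i u).
pose w i j := form (g u) (N i) (E j u).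
have NE i : cov g id (cst z) (E i) u = N i.
  transitivity ('D_z (E i) u + christoffel g u ('D_z id u) (E i u)); first by [].
  by rewrite (derive_id u z).
have wanti i j : w i j = - w j i.
  have := cov_compat mg oU UU (smooth_id U) z Uu (sE i) (sE j).
  have -> : 'D_z (fun u => form (g (id u)) (E i u) (E j u)) u = 0.
    rewrite -[RHS](derive_cst ((i == j)%:R : R) u z).
    by apply: derive_near_eq oU _ Uu => x /set_mem Ux; exact: oE.
  rewrite (NE i) (NE j) (formC (E i u) _ (metric_on_sym mg Uu)).
  by move=> /esym/eqP; rewrite addr_eq0 => /eqP.
have -> : \sum_i B u (E i u) ('D_z (E i) u + C u z (E i u)) =
          \sum_i \sum_j w i j * B u (E i u) (E j u).
  apply: eq_bigr => i _; rewrite -/(N i).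
  refine (etrans (congr1 (B u _) (orthonormal_expand (N i) (oE Uu))) _).
  refine (etrans (bilin_sumr _ _ _ _ (bB Uu)) _); apply: eq_bigr => j _.
  exact: (bilinZr _ _ _ (bB Uu)).
set s := \sum_i _; suff : s = - s by move/eqP; rewrite -addr_eq0 -mulr2n mulrn_eq0 => /eqP.
rewrite {1}/s exchange_big /= -sumrN; apply: eq_bigr => j _.
rewrite -sumrN; apply: eq_bigr => i _.
exact: (etrans (congr2 *%R (wanti i j) (symB (E i u) (E j u) Uu)) (mulNr _ _)).
Qed.

(** The trace commutes with the covariant derivative: [frame_connection_trace] trades the
    derivatives of the frame for Christoffel symbols, and the right-hand side is the trace of the
    covariant derivative of B along z, with the frame frozen at u. *)
Lemma derive_scalar_mean_curvature u z : (0 < m)%N -> U u ->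
  m%:R * 'D_z f u = \sum_i ('D_z (fun x => B x (E i u) (E i u)) u
                            - 2 * B u (E i u) (C u z (E i u))).
Proof.
move=> m0 Uu.
have dBE i := smooth_differentiable (sBE i) Uu.
have sum_diff : differentiable (fun x => \sum_i B x (E i x) (E i x)) u.
  exact: differentiable_sumE.
have -> : m%:R * 'D_z f u = \sum_i 'D_z (fun x => B x (E i x) (E i x)) u.
  rewrite -(derive_sumE z dBE); refine (etrans (congr1 ( *%R _) (derive_mulrE _ z sum_diff)) _).
  by rewrite mulrA mulfV ?mul1r // pnatr_eq0 -lt0n.
have DB i : 'D_z (fun x => B x (E i x) (E i x)) u =
   'D_z (fun x => B x (E i u) (E i u)) u + 2 * B u (E i u) ('D_z (E i) u).
  refine (etrans (derive_bilin oU oU UU (smooth_id U) (sE i) (sE i) bB sB z Uu) _).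
  rewrite (derive_id u z).
  exact: (add_eq_double _ (symB ('D_z (E i) u) (E i u) Uu)).
have -> : \sum_i 'D_z (fun x => B x (E i x) (E i x)) u = \sum_i
   ('D_z (fun x => B x (E i u) (E i u)) u + 2 * B u (E i u) ('D_z (E i) u)).
  by apply: eq_bigr => i _; exact: DB.
have BD i : B u (E i u) ('D_z (E i) u + C u z (E i u)) =
    B u (E i u) ('D_z (E i) u) + B u (E i u) (C u z (E i u)).
  exact: (bilinDr _ _ _ (bB Uu)).
have := frame_connection_trace z Uu.
have -> : \sum_i B u (E i u) ('D_z (E i) u + C u z (E i u)) =
  \sum_i (B u (E i u) ('D_z (E i) u) + B u (E i u) (C u z (E i u))).
  by apply: eq_bigr => i _; exact: BD.
exact: trace_cancel.
Qed.

Section Equation.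
Variable c : R.
Hypothesis m0 : (0 < m)%N.
Hypothesis cK : forall y, O y -> forall v w : 'rV[R]_m.+1, row_free (col_mx v w) ->
  sectional_curvature G y v w = c.
Hypothesis biharm : forall u, U u -> biharmonic_eq G F E u.

Let sf := smooth_scalar_mean_curvature.

(** Since V is orthogonal to the unit tangent vector [De], constant curvature makes each summand of
    the right-hand side of the biharmonic equation equal to - c V. The vector X is taken tangent to
    the hypersurface in one use and equal to nu in the other. *)
Lemma biharmonic_pairing u X : U u ->
  \sum_(i < m) (<[T (E i u) (T (E i u) V) u, X]>_u
                - <[T (C u (E i u) (E i u)) V u, X]>_u) =
  \sum_(i < m) - (c * <[V u, X]>_u).
Proof.
move=> Uu; have sV : smooth_on U V := smooth_scaled_field oU sf snu.
have e1 := etrans (esym (rough_laplacian_mean_curvature Uu)) (biharm Uu).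
have e2 := congr1 (fun p => <[p, X]>_u) (etrans (esym (rough_laplacianE Uu sV)) e1).
have e3 := etrans (esym (form_suml _ _ _ _ _)) (etrans e2 (form_suml _ _ _ _ _)).
refine (etrans (eq_bigr _ _) (etrans e3 (eq_bigr _ _))) => i _.
  exact: (esym (formBl _ _ _ _)).
set De := push F (E i) u.
have nuDe : <[nu u, De]>_u = 0 by exact: nu_normal.
have DeDe : <[De, De]>_u = 1.
  refine (etrans (esym (induced_metricE G sF (E i u) (E i u) Uu)) _).
  by have := oE Uu i i; rewrite eqxx.
have cc := constant_curvature mG (UO Uu) (cK (UO Uu)) De (V u) De X.
refine (etrans (congr1 (fun p => <[curvature G (F u) De p De, X]>_u) (mean_curvatureE Uu)) _).
refine (etrans cc _).
rewrite DeDe /V formZl nuDe mulr0 mul0r mul1r sub0r; exact: mulrN.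
Qed.

Lemma biharmonic_tangential u z : U u ->
  m%:R * f u * 'D_z f u + 2 * \sum_i 'D_(E i u) f u * B u (E i u) z = 0.
Proof.
move=> Uu; have := biharmonic_pairing ('D_z F u) Uu.
have -> : <[V u, 'D_z F u]>_u = 0 by rewrite /V formZl nu_normal // mulr0.
have term i : <[T (E i u) (T (E i u) V) u, 'D_z F u]>_u
              - <[T (C u (E i u) (E i u)) V u, 'D_z F u]>_u =
    - (2 * ('D_(E i u) f u * B u (E i u) z))
    - f u * ('D_z (fun x => B x (E i u) (E i u)) u - 2 * B u (E i u) (C u z (E i u))).
  set e := E i u.
  refine (etrans (congr2 (fun p q => p - q)
    (cov_cov_normal_field_tangential mG oU UO sF iF snu nu_unit nu_normal sf e z Uu)
    (cov_normal_field_tangential mG oU UO sF iF snu nu_unit nu_normal sf (C u e e) z Uu)) _).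
  (* Codazzi exchanges the derivative of B(e, z) along e, a divergence once summed, for that of B(e,
     e) along z; the sum of the latter over the frame is m times the derivative of f. *)
  refine (tangential_term _ _ _ (codazzi mG oU UO sF iF snu nu_unit nu_normal cK e e z Uu) _ _ _).
  - by apply: derive_near_eq oU _ Uu => x /set_mem Ux; exact: symB.
  - exact: (symB _ _ Uu).
  - exact: (congr1 (B u e) (christoffelC mg e z Uu)).
have -> : \sum_(i < m) (<[T (E i u) (T (E i u) V) u, 'D_z F u]>_u
                - <[T (C u (E i u) (E i u)) V u, 'D_z F u]>_u) =
  \sum_i (- (2 * ('D_(E i u) f u * B u (E i u) z))
    - f u * ('D_z (fun x => B x (E i u) (E i u)) u - 2 * B u (E i u) (C u z (E i u)))).
  by apply: eq_bigr => i _; exact: term.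
have -> : \sum_(i < m) - (c * 0) = 0 :> R by rewrite big1 // => i _; rewrite mulr0 oppr0.
exact: (tangential_sum (derive_scalar_mean_curvature z m0 Uu)).
Qed.

Hypothesis c0 : c <= 0.
Hypothesis convex : forall u, U u -> forall k,
  principal_curvature G F (nu u) u k -> 0 <= k.

Let expand u v : U u -> v = \sum_i form (g u) v (E i u) *: E i u.
Proof. by move=> Uu; exact: orthonormal_expand (oE Uu). Qed.

Lemma principal_curvatureP u v k : U u -> v != 0 ->
  (forall w, B u v w = k * form (g u) v w) -> 0 <= k.
Proof. by move=> Uu v0 Bv; apply: (convex Uu); exists v. Qed.

(** The least eigenvalue k of the matrix of B in the orthonormal frame is a principal curvature,
    hence nonnegative. The diagonal entries, of which f is the average, are values of the quadratic
    form at unit vectors and thus at least k. *)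
Lemma scalar_mean_curvature_ge0 u : U u -> 0 <= f u.
Proof.
move=> Uu; pose S := \matrix_(i, j) B u (E i u) (E j u).
have sS : S^T = S by apply/matrixP => i j; rewrite !mxE; exact: symB.
have [k [x x0 [Sx kmin]]] := symmetric_min_eigenvector m0 sS.
pose v := \sum_i x 0 i *: E i u.
have gv j : form (g u) v (E j u) = x 0 j.
  rewrite /v form_suml (bigD1 j) //= big1 ?addr0 => [|i ij]; rewrite formZl.
    by rewrite [form _ _ _](oE Uu) eqxx mulr1.
  by rewrite [form _ _ _](oE Uu) (negPf ij) mulr0.
have v0 : v != 0.
  apply: contra x0 => /eqP v0; apply/eqP/rowP => j.
  by rewrite -gv v0 form0l mxE.
have Bvj j : B u v (E j u) = k * x 0 j.
  have -> : B u v (E j u) = form S x (delta_mx 0 j).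
    refine (etrans (bilin_suml _ _ _ _ (bB Uu)) _).
    rewrite [RHS](bilin_delta _ _ (form_bilin _)); apply: eq_bigr => i _.
    rewrite (bigD1 j) //= big1 ?addr0 => [|l lj]; last first.
      by rewrite mxE (negPf lj) mulr0 scale0r.
    rewrite mxE !eqxx mulr1 form_delta mxE; exact: (bilinZl _ _ _ (bB Uu)).
  by rewrite Sx form1_delta.
have k0 : 0 <= k.
  apply: (principal_curvatureP Uu v0) => w.
  rewrite {2}(expand w Uu) (form_sumr _ _ _ _) mulr_sumr.
  refine (etrans (congr1 (B u v) (expand w Uu)) _).
  refine (etrans (bilin_sumr _ _ _ _ (bB Uu)) _); apply: eq_bigr => j _.
  refine (etrans (bilinZr _ _ _ (bB Uu)) _).
  by rewrite Bvj formZr gv; exact: mulrCA.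
rewrite mulr_ge0 ?invr_ge0 ?ler0n // sumr_ge0 // => i _.
have := kmin (delta_mx 0 i); rewrite !form_delta !mxE eqxx mulr1.
exact: le_trans.
Qed.

Lemma derive_scalar_mean_curvature0 u z : U u -> 0 < f u -> 'D_z f u = 0.
Proof.
move=> Uu fpos; have df := smooth_differentiable sf Uu.
(* The gradient of f for the induced metric; the tangential equation makes it an eigenvector of B
   for the eigenvalue - m f / 2, unless it vanishes. *)
pose X := \sum_i 'D_(E i u) f u *: E i u.
have gX w : 'D_w f u = form (g u) X w.
  rewrite {1}(expand w Uu) derive_dir_sum // form_suml; apply: eq_bigr => i _.
  by rewrite formZl mulrC (formC w _ (metric_on_sym mg Uu)).
have BX w : B u X w = - (m%:R * f u / 2) * form (g u) X w.
  have BXw : B u X w = \sum_i 'D_(E i u) f u * B u (E i u) w.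
    refine (etrans (bilin_suml _ _ _ _ (bB Uu)) _); apply: eq_bigr => i _.
    exact: (bilinZl _ _ _ (bB Uu)).
  have := biharmonic_tangential w Uu; rewrite -BXw gX; exact: solve_eigenvalue.
have [X0|X0] := eqVneq X 0; first by rewrite gX X0 form0l.
have := principal_curvatureP Uu X0 BX.
rewrite oppr_ge0 leNgt divr_gt0 // mulr_gt0 // ltr0n //.
Qed.

Lemma scalar_mean_curvature0 u : U u -> f u = 0.
Proof.
move=> Uu; apply/eqP/negP => /negP f0.
have fpos : 0 < f u by rewrite lt_def f0 scalar_mean_curvature_ge0.
have df0 a : 'D_a f u = 0 by exact: derive_scalar_mean_curvature0.
(* Second derivatives require the first ones to vanish near u, not only at u: by continuity f stays
   positive on a neighbourhood. *)
have ddf0 a : 'D_a ('D_a f) u = 0.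
  rewrite -[RHS](derive_cst (0 : R) u a); apply: near_eq_derive.
  have cf : {for u, continuous f}.
    exact/differentiable_continuous/(smooth_differentiable sf Uu).
  have nf : \forall x \near u, 0 < f x by exact: (cvgr_gt _ cf).
  apply: (filterS _ (filterI (open_nbhs_nbhs (conj oU Uu)) nf)) => x [Ux fx].
  exact: derive_scalar_mean_curvature0.
have := biharmonic_pairing (nu u) Uu.
have term i : <[T (E i u) (T (E i u) V) u, nu u]>_u
              - <[T (C u (E i u) (E i u)) V u, nu u]>_u =
    - (f u * <[T (E i u) nu u, T (E i u) nu u]>_u).
  refine (etrans (congr2 (fun p q => p - q)
    (cov_cov_normal_field_normal mG oU UO sF snu nu_unit sf (E i u) Uu)
    (cov_normal_field_normal mG oU UO sF snu nu_unit sf (C u (E i u) (E i u)) Uu)) _).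
  refine (etrans (congr2 (fun p q => p - _ - q) (ddf0 _) (df0 _)) _).
  by rewrite sub0r subr0.
have -> : \sum_(i < m) (<[T (E i u) (T (E i u) V) u, nu u]>_u
                - <[T (C u (E i u) (E i u)) V u, nu u]>_u) =
  \sum_i - (f u * <[T (E i u) nu u, T (E i u) nu u]>_u).
  by apply: eq_bigr => i _; exact: term.
have -> : <[V u, nu u]>_u = f u by rewrite /V formZl nu_unit // mulr1.
(* The derivative of nu along a unit frame vector is tangent and, up to sign, the shape operator
   applied to it, so the q i sum to |A|^2. *)
pose q i := <[T (E i u) nu u, T (E i u) nu u]>_u.
have q_ge0 i : 0 <= q i by exact: (metric_ge0 mG _ (UO Uu)).
move=> sumq.
have q0 i : q i = 0 by exact: (eq0_of_sum_le0 q_ge0 fpos c0 sumq).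
have BE i : B u (E i u) (E i u) = 0.
  have T0 : T (E i u) nu u = 0 by exact: (metric_eq0 mG (UO Uu) (q0 i)).
  have W := weingarten mG oU UO sF iF snu nu_unit nu_normal (E i u) (E i u) Uu.
  have := etrans (esym (congr1 (fun p => <[p, 'D_(E i u) F u]>_u) T0)) W.
  by rewrite form0l => /esym/eqP; rewrite oppr_eq0 => /eqP.
move: f0; rewrite /f /scalar_mean_curvature big1 ?mulr0 ?eqxx // => i _.
exact: BE.
Qed.

End Equation.

End Biharmonic.

(** Links the local orthonormal frame provided by [biharmonic] to the arbitrary fields of [minimal],
    which are orthonormal at u only. The two are given on different neighbourhoods, hence the
    intersection in the proof. *)
Lemma mean_curvature_frame (R : realType) m n (O : set 'rV[R]_n) G
    (U U' : set 'rV[R]_m) F E E' u :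
  metric_on O G -> open U -> open U' -> (forall u, U u -> O (F u)) -> smooth_on U F ->
  (forall u, U u -> forall v, 'D_v F u = 0 -> v = 0) -> U u -> U' u ->
  (forall i, smooth_on U (E i)) -> (forall i, smooth_on U' (E' i)) ->
  orthonormal_at G F u (fun i => E i u) -> orthonormal_at G F u (fun i => E' i u) ->
  mean_curvature G F E' u = mean_curvature G F E u.
Proof.
move=> mG oU oU' UO sF iF Uu U'u sE sE' oE oE'; refine (congr1 ( *:%R _) _).
have oUU := openI oU oU'; have UUu : (U `&` U') u by [].
have sF' : smooth_on (U `&` U') F by apply: smooth_subset sF => z [].
have bh := second_form_at_bilin mG oU UO sF iF Uu.
have sg := metric_on_sym (induced_metric_on mG oU UO sF iF) Uu.
refine (etrans (eq_bigr _ _)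
  (etrans (orthonormal_trace sg bh oE oE') (esym (eq_bigr _ _)))) => i _.
  apply: (second_form_fieldE G oUU sF' (E' i) UUu).
  by apply: smooth_subset (sE' i) => z [].
exact: (second_form_fieldE G oU sF (E i) Uu (sE i)).
Qed.

(** * From coordinates to the manifolds *)

Section Charts.
Context {R : realType} {n : nat} {N : topologicalType} {AN : manifold R n N}.
Variable g : riemannian_metric AN.

Lemma chart_metric_on b : atlas AN b -> metric_on (coord b @` dom b) (metric g b).
Proof.
move=> Ab; split.
- exact: codom_open.
- exact: metric_smooth.
- by move=> _ [q bq <-]; exact: metric_sym.
- by move=> _ [q bq <-]; exact: metric_pos.
Qed.

End Charts.

Theorem theorem1p3 (R : realType) (m : nat) (c : R)
  (M N : topologicalType)
  (AM : manifold R m M) (AN : manifold R m.+1 N)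
  (g : riemannian_metric AN) (x : M -> N) :
  (0 < m)%N -> c <= 0 ->
  space_form g c ->
  immersion AM AN x ->
  weakly_convex AM x g ->
  biharmonic AM x g ->
  minimal AM x g.
Proof.
move=> m0 c0 [_ _ cK] [[_ sx] ix] [nu [[_ snu] unu cvx]] bih.
move=> a b u Aa Ab abu W' E' oW' W'u sE' oE'.
have [W [E [[oW Wu] Wab sE oE biharm]]] := bih a b u Aa Ab abu.
have mG := chart_metric_on g Ab.
pose F := local_map x a b; pose nuF := nu b \o param a.
(* The hypotheses on nu, its normality and convexity, are stated at points of M; this translates
   them to coordinates in W. *)
have local w : W w -> exists p, [/\ dom a p, dom b (x p), w = coord a p,
    F w = coord b (x p) & nuF w = nu b p].
  move=> /Wab[p [ap bxp] <-]; exists p.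
  by rewrite /F /nuF /local_map /= coordK.
have UO w : W w -> (coord b @` dom b) (F w).
  by move=> /local[p [ap bxp _ -> _]]; exists (x p).
have sF : smooth_on W F by apply: smooth_subset (sx a b Aa Ab).
have iF w : W w -> forall v, 'D_v F w = 0 -> v = 0.
  by move=> /Wab; exact: ix.
have sn : smooth_on W nuF by apply: smooth_subset (snu a b Aa Ab).
have nu1 w : W w -> form (metric g b (F w)) (nuF w) (nuF w) = 1.
  by move=> /local[p [ap bxp _ -> ->]]; case: (unu a b p Aa Ab ap bxp).
have nu0 w : W w -> forall v, form (metric g b (F w)) (nuF w) ('D_v F w) = 0.
  by move=> /local[p [ap bxp wp -> ->]] v; rewrite wp; case: (unu a b p Aa Ab ap bxp).
have cKO y : (coord b @` dom b) y -> forall v w : 'rV[R]_m.+1,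
    row_free (col_mx v w) -> sectional_curvature (metric g b) y v w = c.
  by move=> [q bq <-]; exact: cK.
have cvxW w : W w -> forall k, principal_curvature (metric g b) F (nuF w) w k -> 0 <= k.
  by move=> /local[p [ap bxp -> _ ->]]; exact: cvx.
rewrite -/F (mean_curvature_frame mG oW oW' UO sF iF Wu W'u sE sE' (oE u Wu) oE').
rewrite (mean_curvatureE mG oW UO sF iF nu1 nu0 sE Wu).
have f0 := scalar_mean_curvature0 mG oW UO sF iF sn nu1 nu0 sE oE m0 cKO biharm c0 cvxW Wu.
by rewrite f0 scale0r.
Qed.
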